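(* Let $N\ge3$ be an integer, and let $\mathcal T_N$, $U_j$, $G_1,\ldots,G_4$, $\Theta$, $\hat\Theta$ be as in the context. The extremizers $P_N(z)$ of $a_3$ over $\mathcal T_N$ given below imply the following sine extremizers $\operatorname{Im}\{P_N(e^{it})\}$ (values at zeros of denominators being understood by continuity). (a) If $N$ is odd, $y_N^{(1)}$ is the maximum root of $U_{(N+3)/2}(x)=0$, and $P_N(z)=G_1(z,y_N^{(1)})+G_2(z,y_N^{(1)})$ (maximum of $a_3$), then $$\operatorname{Im}\{P_N(e^{it})\}=\Theta(t,y_N^{(1)}).$$ (b) If $N$ is even, $y_N^{(3)}$ is the maximum root of $U_{(N+2)/2}(x)=0$, and $P_N(z)=\big(G_1(z,y_N^{(3)})+G_2(z,y_N^{(3)})\big)\big(1+\tau\frac{z+z^{-1}}2\big)-\frac\tau2$ (maximum of $a_3$), then $$\operatorname{Im}\{P_N(e^{it})\}=\Theta(t,y_N^{(3)})(1+\tau\cos t),\qquad\tau\in[-1,1].$$ (c) If $N$ and $(N+3)/2$ are odd, $y_N^{(5)}$ is the minimum positive root of $U'_{(N+3)/2}(x)=0$, and $P_N(z)=G_3(z,y_N^{(5)})+G_4(z,y_N^{(5)})$ (minimum of $a_3$), then $$\operatorname{Im}\{P_N(e^{it})\}=\hat\Theta(t,y_N^{(5)}).$$ (d) If $N$ is odd while $(N+3)/2$ is even, $y_N^{(2)}$ is the minimum positive root of $U_{(N+3)/2}(x)=0$, and $P_N(z)=G_1(z,y_N^{(2)})+G_2(z,y_N^{(2)})$ (minimum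 of $a_3$), then $$\operatorname{Im}\{P_N(e^{it})\}=\Theta(t,y_N^{(2)}).$$ (e) If $N$ is even while $(N+2)/2$ is odd, $y_N^{(6)}$ is the minimum positive root of $U'_{(N+2)/2}(x)=0$, and $P_N(z)=\big(G_3(z,y_N^{(6)})+G_4(z,y_N^{(6)})\big)\big(1+\tau\frac{z+z^{-1}}2\big)-\frac\tau2$ (minimum of $a_3$), then $$\operatorname{Im}\{P_N(e^{it})\}=\hat\Theta(t,y_N^{(6)})(1+\tau\cos t),\qquad\tau\in[-1,1].$$ (f) If $N$ and $(N+2)/2$ are even, $y_N^{(4)}$ is the minimum positive root of $U_{(N+2)/2}(x)=0$, and $P_N(z)=\big(G_1(z,y_N^{(4)})+G_2(z,y_N^{(4)})\big)\big(1+\tau\frac{z+z^{-1}}2\big)-\frac\tau2$ (minimum of $a_3$), then $$\operatorname{Im}\{P_N(e^{it})\}=\Theta(t,y_N^{(4)})(1+\tau\cos t),\qquad\tau\in[-1,1].$$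
   Context: Let $\mathbb D=\{z\in\mathbb C:|z|<1\}$. A holomorphic function $F$ on $\mathbb D$ is typically real if $F(z)\in\mathbb R$ for all $z\in\mathbb D\cap\mathbb R$ and $\operatorname{Im}F(z)\cdot\operatorname{Im}z>0$ for all $z\in\mathbb D\setminus\mathbb R$. $\mathcal T_N$ is the set of normalized typically real polynomials of degree $N$, $P(z)=z+\sum_{j=2}^N a_jz^j$ with $a_N\ne0$, on $\mathbb D$; their coefficients are real, and $\operatorname{Im}\{P(e^{it})\}=\sin t+\sum_{j=2}^N a_j\sin jt$. An extremizer of $a_3$ over $\mathcal T_N$ is a polynomial attaining the maximum (resp. minimum) of the coefficient $a_3$ of $z^3$. A sine extremizer for $a_3$ is a sine polynomial attaining the maximum (resp. minimum) of $a_3$ in the class of sine polynomials $S(t)=\sin t+\sum_{j=2}^N a_j\sin jt$, $a_N\neq0$, non-negative on $[0,\pi]$. $U_j$ is the Chebyshev polynomial of the second kind, $U_j(\cos t)=\sin((j+1)t)/\sin t$, and $U_j'$ its derivative. Let $M=N+5$ if $N$ is odd and $M=N+4$ if $N$ is even. Define $$\Theta(t,y)=\frac{2y^2(1-y^2)}{\sin t}\cdot\frac{\sin^2\frac{M}{2}t}{M(\cos^2t-y^2)^2},$$ $$\hat\Theta(t,y)=\frac{2y^2(1-y^2)}{\sin^3t}\cdot\frac{\left(\frac{M+2}{2}\sin\frac{M-2}{2}t-\frac{M-2}{2}\sin\frac{M+2}{2}t\right)^2}{(M-2)M(M+2)(\cos^2t-y^2)^2},$$ $$G_1(z,y)=\frac{32\,y^2(1-y^2)z^5}{(1-z^2)(1+z^4+2(1-2y^2)z^2)^2}\cdot\frac{1-z^{M}}{M},\qquad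 G_2(z,y)=\frac{z+z^3}{1+z^4+2(1-2y^2)z^2},$$ $$G_3(z,y)=\frac{-32y^2(1-y^2)z^7}{(1+z^4+2(1-2y^2)z^2)^2}\cdot\frac{(M+2)^2(1-z^{M-2})+(M-2)^2(1-z^{M+2})-2(M-2)(M+2)(z^2-z^{M})}{(M-2)M(M+2)(1-z^2)^3},$$ $$G_4(z,y)=\frac{(z+z^3)\big(1+z^8-\gamma_1(y)(z^2+z^6)+\gamma_2(y)z^4\big)}{(1-z^2)^2(1+z^4+2(1-2y^2)z^2)^2},$$ where $\gamma_1(y)=4y^2$ and $\gamma_2(y)=2\left(-\frac{16}{M}y^4+4\left(1+\frac4M\right)y^2-1\right)$. The rational functions $P_N$ are extended by continuity at their removable singularities.
   Formalization: For N even and τ=0 the polynomial P_N has a_N=0, so it is not in T_N (nor is its imaginary part in the sine class); there extremality of a_3 is asserted among polynomials, resp. sine polynomials, of degree at most N, with the condition a_N≠0 dropped. *)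

(* Defs.v *)
(* Complex numbers are R[i], over R : realType. *)
From mathcomp Require Export all_boot all_order all_algebra.
From mathcomp Require Export complex.
From mathcomp Require Export boolp classical_sets reals topology normedtype trigo.
From mathcomp Require Import ring.
Export numFieldNormedType.Exports.
Export Order.TTheory GRing.Theory Num.Theory.

Set Implicit Arguments.
Unset Strict Implicit.
Unset Printing Implicit Defensive.


Local Open Scope classical_set_scope.
Local Open Scope complex_scope.
Local Open Scope ring_scope.

Fixpoint chebyshevU (R : nzRingType) (n : nat) : {poly R} :=
  match n with
  | 0 => 1
  | n1.+1 => match n1 with
             | 0 => 2 *: 'X
             | n2.+1 => 2 *: ('X * chebyshevU R n1) - chebyshevU R n2
             end
  end.

Lemma chebyshevU_cos (R : realType) (n : nat) (t : R) :
  (chebyshevU R n).[cos t] * sin t = sin (n.+1%:R * t).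
Proof.
suff: (chebyshevU R n).[cos t] * sin t = sin (n.+1%:R * t) /\
      (chebyshevU R n.+1).[cos t] * sin t = sin (n.+2%:R * t) by case.
elim: n => [|n [IH0 IH1]].
  rewrite /= hornerC hornerZ hornerX !mul1r; split=> //.
  have -> : 2 * t = t + t by ring.
  by rewrite sinD; ring.
split=> //.
have -> : chebyshevU R n.+2 = 2 *: ('X * chebyshevU R n.+1) - chebyshevU R n.
  by [].
rewrite hornerD hornerN hornerZ mulrC ['X * _]mulrC hornerMX.
transitivity (2 * cos t * ((chebyshevU R n.+1).[cos t] * sin t)
              - (chebyshevU R n).[cos t] * sin t); first by ring.
rewrite IH0 IH1.
have -> : n.+3%:R * t = n.+2%:R * t + t by rewrite -natr1 mulrDl mul1r.
have -> : n.+1%:R * t = n.+2%:R * t - t.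
  by rewrite -(natr1 n.+1) mulrDl mul1r addrK.
by rewrite sinB sinD; ring.
Qed.

Definition is_max_root (R : realType) (q : {poly R}) (y : R) : Prop :=
  root q y /\ forall x, root q x -> x <= y.

Definition is_min_pos_root (R : realType) (q : {poly R}) (y : R) : Prop :=
  [/\ 0 < y, root q y & forall x, 0 < x -> root q x -> y <= x].

Definition is_maximizer (d : Order.disp_t) (V : porderType d) (X : Type)
    (f : X -> V) (A : set X) (x : X) : Prop :=
  A x /\ forall x', A x' -> (f x' <= f x)%O.

Definition is_minimizer (d : Order.disp_t) (V : porderType d) (X : Type)
    (f : X -> V) (A : set X) (x : X) : Prop :=
  A x /\ forall x', A x' -> (f x <= f x')%O.

(* f is the expression g, where at the points at which a denominator of g
   vanishes (those that do not satisfy reg) the value of g is its limit. *)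
Definition eq_by_continuity (K : numFieldType) (reg : pred K) (f g : K -> K)
    : Prop :=
  forall x, (reg x -> f x = g x) /\ (~~ reg x -> g u @[u --> x^'] --> f x).

(* Only applied to polynomial functions, hence no holomorphy requirement. *)
Definition typically_real (R : realType) (F : R[i] -> R[i]) : Prop :=
  (forall z, `|z| < 1 -> complex.Im z = 0 -> complex.Im (F z) = 0) /\
  (forall z, `|z| < 1 -> complex.Im z != 0 ->
     0 < complex.Im (F z) * complex.Im z).

Definition typreal_le (R : realType) (N : nat) : set {poly R[i]} :=
  [set p : {poly R[i]} | [/\ (size p <= N.+1)%N, p`_0 = 0, p`_1 = 1
             & typically_real (horner p)]].

Definition typreal (R : realType) (N : nat) : set {poly R[i]} :=
  [set p : {poly R[i]} | typreal_le N p /\ p`_N != 0].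

(* The order of R[i] restricts to the usual one on real numbers, and only
   compares numbers with the same imaginary part; the coefficients of a
   typically real polynomial are real. *)
Definition a3 (R : realType) (p : {poly R[i]}) : R[i] := p`_3.

(* A sine polynomial of degree N is given by its coefficients a_2, ..., a_N;
   the other values of a are irrelevant. *)
Definition sine_poly (R : realType) (N : nat) (a : nat -> R) (t : R) : R :=
  sin t + \sum_(2 <= j < N.+1) a j * sin (j%:R * t).

Definition nonneg_sine_le (R : realType) (N : nat) : set (nat -> R) :=
  [set a : nat -> R | forall t, 0 <= t <= pi -> 0 <= sine_poly N a t].

Definition nonneg_sine (R : realType) (N : nat) : set (nat -> R) :=
  [set a : nat -> R | nonneg_sine_le N a /\ a N != 0].

Definition sine_maximizer (R : realType) (N : nat) (A : set (nat -> R))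
    (S : R -> R) : Prop :=
  exists a, S = sine_poly N a /\ is_maximizer (fun b : nat -> R => b 3%N) A a.

Definition sine_minimizer (R : realType) (N : nat) (A : set (nat -> R))
    (S : R -> R) : Prop :=
  exists a, S = sine_poly N a /\ is_minimizer (fun b : nat -> R => b 3%N) A a.

(* t |-> Im p(e^{it}) *)
Definition im_circle (R : realType) (p : {poly R[i]}) (t : R) : R :=
  complex.Im p.[cos t +i* sin t].

Definition Mdeg (N : nat) : nat := if odd N then (N + 5)%N else (N + 4)%N.

Section Formulas.
Variable R : realType.
Implicit Types (M : nat) (t y : R).

Definition Theta M t y : R :=
  2 * y ^+ 2 * (1 - y ^+ 2) / sin t *
  (sin (M%:R / 2 * t) ^+ 2 / (M%:R * (cos t ^+ 2 - y ^+ 2) ^+ 2)).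

Definition hatTheta M t y : R :=
  2 * y ^+ 2 * (1 - y ^+ 2) / sin t ^+ 3 *
  (((M%:R + 2) / 2 * sin ((M%:R - 2) / 2 * t)
    - (M%:R - 2) / 2 * sin ((M%:R + 2) / 2 * t)) ^+ 2 /
   ((M%:R - 2) * M%:R * (M%:R + 2) * (cos t ^+ 2 - y ^+ 2) ^+ 2)).

Definition Theta_reg y : pred R :=
  fun t => (sin t != 0) && (cos t ^+ 2 - y ^+ 2 != 0).

End Formulas.

Section RationalFormulas.
Variable K : fieldType.
Implicit Types (M : nat) (z y : K).

Definition quartic z y : K := 1 + z ^+ 4 + 2 * (1 - 2 * y ^+ 2) * z ^+ 2.

Definition G1 M z y : K :=
  32 * y ^+ 2 * (1 - y ^+ 2) * z ^+ 5 / ((1 - z ^+ 2) * quartic z y ^+ 2) *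
  ((1 - z ^+ M) / M%:R).

Definition G2 z y : K := (z + z ^+ 3) / quartic z y.

Definition G3 M z y : K :=
  - 32 * y ^+ 2 * (1 - y ^+ 2) * z ^+ 7 / quartic z y ^+ 2 *
  (((M%:R + 2) ^+ 2 * (1 - z ^+ (M - 2)) + (M%:R - 2) ^+ 2 * (1 - z ^+ (M + 2))
    - 2 * (M%:R - 2) * (M%:R + 2) * (z ^+ 2 - z ^+ M)) /
   ((M%:R - 2) * M%:R * (M%:R + 2) * (1 - z ^+ 2) ^+ 3)).

Definition gamma1 y : K := 4 * y ^+ 2.

Definition gamma2 M y : K :=
  2 * (- (16 / M%:R) * y ^+ 4 + 4 * (1 + 4 / M%:R) * y ^+ 2 - 1).

Definition G4 M z y : K :=
  (z + z ^+ 3) *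
  (1 + z ^+ 8 - gamma1 y * (z ^+ 2 + z ^+ 6) + gamma2 M y * z ^+ 4) /
  ((1 - z ^+ 2) ^+ 2 * quartic z y ^+ 2).

Definition G_reg y : pred K :=
  fun z => (1 - z ^+ 2 != 0) && (quartic z y != 0).

(* The factor (z + z^{-1}) / 2 adds the pole z = 0. *)
Definition G_reg0 y : pred K := fun z => (z != 0) && G_reg y z.

Definition twist (tau : K) (G : K -> K) (z : K) : K :=
  G z * (1 + tau * ((z + z^-1) / 2)) - tau / 2.

End RationalFormulas.

(* For tau = 0 the coefficient of z^N of the twisted polynomial (and that of
   sin Nt of its imaginary part) vanishes, so that extremality is then meant
   among the polynomials of degree at most N. *)
Definition typreal_tau (R : realType) (tau : R) (N : nat) : set {poly R[i]} :=
  if tau == 0 then typreal_le N else typreal N.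

Definition nonneg_sine_tau (R : realType) (tau : R) (N : nat)
    : set (nat -> R) :=
  if tau == 0 then nonneg_sine_le N else nonneg_sine N.

(* Main.v *)
(* A sine polynomial S(t) = sin t + ... that is nonnegative on [0, pi] has
   a_3 - (4y^2 - 1) = 4 I((x^2 - y^2) q), where S(t) = sin t * q(cos t) and I is
   the normalized integral for the weight sqrt(1 - x^2). On polynomials of
   degree < 2n, I is given both by the Gauss quadrature at the zeros of U_n and
   by the Gauss-Lobatto quadrature at -1, 1 and the zeros of U_n', with
   nonnegative weights. If y^2 is the largest (smallest) square of a node, then
   a_3 <= 4y^2 - 1 (resp. a_3 >= 4y^2 - 1).
   The rational functions of z are z * num(z^2) / den(z^2), and den divides num
   because the zeros exp(2i theta), exp(-2i theta) of den other than 1, where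
   y = cos theta, are double zeros of num. The resulting polynomial has
   a_3 = 4y^2 - 1, and its imaginary part on the circle is nonnegative on
   [0, pi]; by a discrete Poisson formula, this makes it typically real. *)
Require Import Defs.
From mathcomp Require Import ring lra zify.
From mathcomp Require Import functions sequences polyrcf.

Local Open Scope classical_set_scope.
Local Open Scope complex_scope.
Local Open Scope ring_scope.

(** * Chebyshev polynomials of the second kind *)

(** Let [n] be given by M = 2(n + 1). It is the least integer with N + 2 <= 2n, so (x^2 - y^2) q, of
    degree at most N + 1, lies within the exactness of both quadratures. Equality in the bound makes
    S vanish at every interior node with x^2 <> y^2. This explains the extremal functions: for x =
    cos t, [Theta] is a constant times sin t (U_n(x) / (x^2 - y^2))^2, and [hatTheta] a constant
    times sin t (1 - x^2) (U_n'(x) / (x^2 - y^2))^2. For the minimum, parity decides. If n is even,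
    0 is not a Gauss node. If n is odd, it is one, and the Gauss nodes would only give a_3 >= -1;
    but then U_n' does not vanish at 0, and the Lobatto nodes give the right bound. Only the Gauss
    rule is computed, by orthogonality of sines at the points k pi / (n + 1). The Lobatto rule
    follows because the Gauss sum of (1 - x^2) U_n' g vanishes for deg g < n - 1. For even N the
    spare degree is taken up by the factor 1 + tau cos t, which affects only the even coefficients
    and hence not a_3. *)

Section Chebyshev.
Set Implicit Arguments.
Unset Strict Implicit.
Variable R : realType.
Local Notation U := (chebyshevU R).

Lemma chebyshevUS n : U n.+2 = 2 *: ('X * U n.+1) - U n.
Proof. by []. Qed.

Lemma horner_chebyshevUS n x : (U n.+2).[x] = 2 * x * (U n.+1).[x] - (U n).[x].
Proof.
by rewrite chebyshevUS hornerD hornerN hornerZ hornerM hornerX mulrA.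
Qed.

Lemma horner_deriv_chebyshevUS n x :
  (U n.+2)^`().[x] =
  2 * (U n.+1).[x] + 2 * x * (U n.+1)^`().[x] - (U n)^`().[x].
Proof.
rewrite chebyshevUS derivB derivZ derivM derivX.
by rewrite hornerD hornerN hornerZ hornerD mul1r hornerM hornerX; ring.
Qed.

Lemma size_chebyshevU n : size (U n) = n.+1.
Proof.
suff: size (U n) = n.+1 /\ size (U n.+1) = n.+2 by case.
elim: n => [|n [IH0 IH1]].
  by rewrite /= size_polyC oner_eq0 size_scale ?pnatr_eq0 // size_polyX.
split=> //; rewrite chebyshevUS.
have U0 : U n.+1 != 0 by rewrite -size_poly_eq0 IH1.
have sz : size (2 *: ('X * U n.+1) : {poly R}) = n.+3.
  by rewrite size_scale ?pnatr_eq0 // mulrC size_mulX // IH1.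
by rewrite size_polyDl ?sz // size_polyN IH0.
Qed.

(** Excludes roots at or beyond 1. The induction must also carry monotonicity in the index, which
    the recurrence preserves because 2x >= 2. *)
Lemma chebyshevU_gt0 n (x : R) : 1 <= x -> 0 < (U n).[x].
Proof.
move=> x1.
suff: 0 < (U n).[x] /\ (U n).[x] < (U n.+1).[x] by case.
elim: n => [|n [IH0 IH1]].
  by rewrite /= hornerC hornerZ hornerX; split; lra.
rewrite horner_chebyshevUS; split; first lra.
have : 0 <= (x - 1) * (U n.+1).[x] by apply: mulr_ge0; lra.
lra.
Qed.

Lemma horner_chebyshevUN n x : (U n).[- x] = (-1) ^+ n * (U n).[x].
Proof.
suff: (U n).[- x] = (-1) ^+ n * (U n).[x] /\
      (U n.+1).[- x] = (-1) ^+ n.+1 * (U n.+1).[x] by case.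
elim: n => [|n [IH0 IH1]].
  by rewrite /= !(hornerC, hornerZ, hornerX); split; ring.
by split=> //; rewrite !horner_chebyshevUS IH0 IH1 !exprS; ring.
Qed.

Lemma horner_deriv_chebyshevUN n x :
  (U n)^`().[- x] = (-1) ^+ n.+1 * (U n)^`().[x].
Proof.
suff: (U n)^`().[- x] = (-1) ^+ n.+1 * (U n)^`().[x] /\
      (U n.+1)^`().[- x] = (-1) ^+ n.+2 * (U n.+1)^`().[x] by case.
elim: n => [|n [IH0 IH1]].
  by rewrite /= derivC derivZ derivX !(hornerC, hornerZ); split; ring.
split=> //.
by rewrite !horner_deriv_chebyshevUS horner_chebyshevUN IH0 IH1 !exprS; ring.
Qed.

Lemma root_chebyshevUN n x : root (U n) (- x) = root (U n) x.
Proof. by rewrite /root horner_chebyshevUN mulf_eq0 signr_eq0. Qed.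

Lemma root_deriv_chebyshevUN n x : root (U n)^`() (- x) = root (U n)^`() x.
Proof. by rewrite /root horner_deriv_chebyshevUN mulf_eq0 signr_eq0. Qed.

Lemma chebyshevU0 n : (U n).[0] = if odd n then 0 else (-1) ^+ n./2.
Proof.
suff: (U n).[0] = (if odd n then 0 else (-1) ^+ n./2) /\
      (U n.+1).[0] = (if ~~ odd n then 0 else (-1) ^+ n.+1./2) by case.
elim: n => [|n [IH0 IH1]].
  by rewrite /= !(hornerC, hornerZ, hornerX); split; ring.
split=> //; rewrite horner_chebyshevUS IH0 /=.
by case: (odd n); rewrite ?exprS //=; ring.
Qed.

Lemma deriv_chebyshevU0 n : odd n -> (U n)^`().[0] = (-1) ^+ n./2 * n.+1%:R.
Proof.
elim/ltn_ind: n => -[|[|n]] // IH.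
  by rewrite /= derivZ derivX hornerZ hornerC expr0 => _; ring.
rewrite [odd _]/= negbK => on.
rewrite horner_deriv_chebyshevUS (IH n) // chebyshevU0 oddS on.
have [-> ->] : n.+1./2 = n./2.+1 /\ n.+2./2 = n./2.+1.
  by rewrite /= uphalf_half on.
rewrite /negb.
by rewrite [(-1) ^+ n./2.+1]exprS -!natr1; ring.
Qed.

(** Since the roots are symmetric about 0, the absence of the root 0 gives the least positive root
    the smallest square among all roots. The next lemma serves the same purpose for U_n' with [n]
    odd. *)
Lemma chebyshevU_root0 n : ~~ odd n -> ~~ root (U n) 0.
Proof. by move=> en; rewrite /root chebyshevU0 (negbTE en) signr_eq0. Qed.

Lemma deriv_chebyshevU_root0 n : odd n -> ~~ root (U n)^`() 0.
Proof.
by move=> on; rewrite /root deriv_chebyshevU0 // mulf_eq0 signr_eq0 pnatr_eq0.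
Qed.

(** This is the derivative of [chebyshevU_cos] in t, cleared of denominators by product-to-sum
    formulas, and proved by the recurrence. For M = 2(n + 1) the right-hand side is the expression
    squared in [hatTheta]. *)
Lemma deriv_chebyshevU_cos n (t : R) :
  2 * sin t ^+ 3 * (U n)^`().[cos t] =
  n.+2%:R * sin (n%:R * t) - n%:R * sin (n.+2%:R * t).
Proof.
suff: 2 * sin t ^+ 3 * (U n)^`().[cos t] =
        n.+2%:R * sin (n%:R * t) - n%:R * sin (n.+2%:R * t) /\
      2 * sin t ^+ 3 * (U n.+1)^`().[cos t] =
        n.+3%:R * sin (n.+1%:R * t) - n.+1%:R * sin (n.+3%:R * t) by case.
have pyth : cos t ^+ 2 = 1 - sin t ^+ 2 by have := cos2Dsin2 t; lra.
elim: n => [|n [IH0 IH1]].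
  rewrite /= derivC derivZ derivX hornerC hornerZ hornerC !mul0r sin0 mulr0.
  split; first ring.
  have -> : 3 * t = t + t + t by ring.
  rewrite mul1r !(sinD, cosD).
  ring: pyth.
split=> //.
rewrite horner_deriv_chebyshevUS.
have UE := chebyshevU_cos n.+1 t.
transitivity (4 * sin t ^+ 2 * ((U n.+1).[cos t] * sin t)
   + 2 * cos t * (2 * sin t ^+ 3 * (U n.+1)^`().[cos t])
   - 2 * sin t ^+ 3 * (U n)^`().[cos t]); first ring.
rewrite UE IH0 IH1.
set b := n.+2%:R * t.
have -> : n.+4%:R * t = b + t + t by rewrite /b -2!natr1; ring.
have -> : n.+3%:R * t = b + t by rewrite /b -natr1; ring.
have -> : n.+1%:R * t = b - t by rewrite /b -(natr1 n.+1); ring.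
have -> : n%:R * t = b - t - t by rewrite /b -!natr1; ring.
rewrite !(sinD, cosD, sinN, cosN) -!natr1.
ring: pyth.
Qed.

End Chebyshev.

(** * Sums of sines over equidistant nodes *)

Section SineSums.
Set Implicit Arguments.
Unset Strict Implicit.
Variable R : realType.
Implicit Types (t x y : R) (b : nat -> R).

(** For 0 < k <= n the cosines are the zeros of U_n. The index 0 is kept in the sums below: it
    contributes nothing where a sine is a factor, and it makes the cosine sums uniform. *)
Definition node n k : R := k%:R * (pi / n.+1%:R).

Lemma node_pi n k : n.+1%:R * node n k = k%:R * pi.
Proof. by rewrite /node mulrCA [_ * (pi / _)]mulrC divfK ?pnatr_eq0. Qed.

Lemma cos_natpi k : cos (k%:R * pi : R) = (-1) ^+ k.
Proof.
elim: k => [|k IH]; first by rewrite mul0r cos0.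
by rewrite -natr1 mulrDl mul1r cosDpi IH exprS; ring.
Qed.

Lemma sin_natpi k : sin (k%:R * pi : R) = 0.
Proof.
elim: k => [|k IH]; first by rewrite mul0r sin0.
by rewrite -natr1 mulrDl mul1r sinDpi IH oppr0.
Qed.

Lemma sin_node n k : sin (n.+1%:R * node n k) = 0.
Proof. by rewrite node_pi sin_natpi. Qed.

Lemma node_itv n k : (k < n.+1)%N -> 0 <= node n k <= pi.
Proof.
move=> kn; rewrite /node; have pi0 := pi_gt0 R.
have n0 : 0 < n.+1%:R :> R by rewrite ltr0n.
apply/andP; split; first by rewrite mulr_ge0 // divr_ge0 // ltW.
rewrite mulrCA ger_pMr //.
by rewrite ler_pdivrMr // mul1r ler_nat ltnW.
Qed.

Lemma node_itv_oo n k : (0 < k < n.+1)%N -> 0 < node n k < pi.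
Proof.
move=> /andP[k0 kn]; rewrite /node; have pi0 := pi_gt0 R.
have n0 : 0 < n.+1%:R :> R by rewrite ltr0n.
rewrite mulr_gt0 ?divr_gt0 ?ltr0n //= mulrCA gtr_pMr //.
by rewrite ltr_pdivrMr // mul1r ltr_nat.
Qed.

(** Multiplication by 2 sin h, where h is half the step, makes the sum telescope. The bound on [l]
    puts h strictly between 0 and pi, so that sin h can be cancelled. *)
Lemma sum_cos_node n l : (0 < l < n.+1.*2)%N ->
  \sum_(k < n.+1) cos (l%:R * node n k) = (1 - (-1) ^+ l) / 2.
Proof.
move=> /andP[l0 ln]; pose h : R := l%:R * (pi / n.+1.*2%:R).
have pi0 := pi_gt0 R.
have n0 : 0 < n.+1.*2%:R :> R by rewrite ltr0n.
have sh0 : sin h != 0.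
  rewrite gt_eqF // sin_gt0_pi // /h mulr_gt0 ?divr_gt0 ?ltr0n //=.
  by rewrite mulrCA gtr_pMr // ltr_pdivrMr // mul1r ltr_nat.
have nodeE k : l%:R * node n k = k%:R * (2 * h).
  rewrite /node /h -mul2n natrM; field.
  by rewrite nat1r pnatr_eq0.
have tele m : 2 * sin h * \sum_(k < m) cos (l%:R * node n k) =
    sin (m%:R * (2 * h) - h) + sin h.
  elim: m => [|m IH]; first by rewrite big_ord0 mul0r sub0r sinN; ring.
  rewrite big_ord_recr /= mulrDr IH nodeE -(natr1 m).
  have -> : (m%:R + 1) * (2 * h) - h = m%:R * (2 * h) + h by ring.
  by rewrite !(sinD, sinN, cosN); ring.
have hE : n.+1%:R * (2 * h) = l%:R * pi.
  rewrite /h -mul2n natrM; field.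
  by rewrite nat1r pnatr_eq0.
have := tele n.+1; rewrite hE sinB cos_natpi sin_natpi => E.
have two0 : (2 : R) != 0 by rewrite pnatr_eq0.
by apply: (mulfI (mulf_neq0 two0 sh0)); rewrite E; field.
Qed.

(** Product-to-sum turns this into cosine sums at the frequencies i - j and i + j. These have the
    same parity, so the sums cancel unless i = j; the bound on i + j rules out aliasing. *)
Lemma sine_orthogonality n i j : (0 < i)%N -> (i + j < n.+1.*2)%N ->
  \sum_(k < n.+1) sin (i%:R * node n k) * sin (j%:R * node n k) =
  (i == j)%:R * (n.+1%:R / 2).
Proof.
wlog ij : i j / (j <= i)%N => [hw i0 ijn|].
  case: (leqP j i) => ij; first exact: hw.
  rewrite eq_sym -hw //; [|exact: ltnW|exact: leq_trans ij|by rewrite addnC].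
  by apply: eq_bigr => k _; rewrite mulrC.
move=> i0 ijn.
transitivity ((\sum_(k < n.+1) cos ((i - j)%:R * node n k)
   - \sum_(k < n.+1) cos ((i + j)%:R * node n k)) / 2).
  rewrite -sumrB mulr_suml; apply: eq_bigr => k _.
  rewrite natrB // natrD [(_ - _) * node _ _]mulrBl [(_ + _) * node _ _]mulrDl.
  by rewrite cosB cosD; field.
rewrite (sum_cos_node (l := i + j)) ?ijn ?addn_gt0 ?i0 //.
have [->|nij] := eqVneq i j.
  rewrite subnn; under eq_bigr do rewrite mul0r cos0.
  rewrite sumr_const card_ord addnn -mul2n exprM sqrrN !expr1n.
  by rewrite subrr mul0r subr0 mul1r.
rewrite sum_cos_node; last by lia.
have -> : (i + j = (i - j) + j.*2)%N by lia.
by rewrite exprD -mul2n [_ ^+ (2 * j)]exprM sqrrN !expr1n mulr1 subrr !mul0r.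
Qed.

Definition sine_sum N b t := \sum_(j < N.+1) b j * sin (j%:R * t).

(** [sine_poly] ignores [a 0] and [a 1]; the value at 1 is replaced by the normalized coefficient so
    that all frequencies can be treated alike. *)
Lemma sine_polyE N (a : nat -> R) t : (0 < N)%N ->
  sine_poly N a t = sine_sum N (fun j => if j == 1%N then 1 else a j) t.
Proof.
move=> N0; rewrite /sine_poly /sine_sum.
rewrite -(big_mkord xpredT
  (fun j : nat => (if j == 1%N then 1 else a j) * sin (j%:R * t))).
rewrite big_ltn // big_ltn // mul0r sin0 mulr0 add0r eqxx !mul1r; congr (_ + _).
by apply: eq_big_nat => j /andP[j2 _]; rewrite gtn_eqF.
Qed.

(** Discrete Fourier inversion: no frequency up to N is aliased with i. *)
Lemma sine_sum_coef N b n i : (0 < i <= N)%N -> (N + i < n.+1.*2)%N ->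
  \sum_(k < n.+1) sin (i%:R * node n k) * sine_sum N b (node n k) =
  n.+1%:R / 2 * b i.
Proof.
move=> /andP[i0 iN] Nn; rewrite /sine_sum.
under eq_bigr do rewrite mulr_sumr.
rewrite exchange_big /=.
transitivity (\sum_(j < N.+1) b j * ((i == j)%:R * (n.+1%:R / 2))).
  apply: eq_bigr => j _.
  rewrite -(sine_orthogonality (n := n)) //; last first.
    by have := ltn_ord j; lia.
  by rewrite mulr_sumr; apply: eq_bigr => k _; rewrite mulrCA.
have iN' : (i < N.+1)%N by [].
rewrite (bigD1 (Ordinal iN')) //= eqxx mul1r big1 ?addr0 1?mulrC // => j.
by rewrite -val_eqE eq_sym /= => /negbTE ->; rewrite mul0r mulr0.
Qed.

Lemma sin3 t : sin (3 * t) = (4 * cos t ^+ 2 - 1) * sin t.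
Proof.
have pyth : sin t ^+ 2 = 1 - cos t ^+ 2 by have := cos2Dsin2 t; lra.
have -> : 3 * t = t + t + t by ring.
by rewrite !(sinD, cosD); ring: pyth.
Qed.

(** By [sin3], 4 (cos^2 t - y^2) sin t = sin 3t - (4 y^2 - 1) sin t, and pairing with S at the nodes
    extracts the coefficients a_3 and a_1 = 1. *)
Lemma sine_a3 N (a : nat -> R) n y : (3 <= N)%N -> (N + 3 < n.+1.*2)%N ->
  \sum_(k < n.+1) 4 * (cos (node n k) ^+ 2 - y ^+ 2) *
     (sin (node n k) * sine_poly N a (node n k)) =
  n.+1%:R / 2 * (a 3 - (4 * y ^+ 2 - 1)).
Proof.
move=> N3 Nn; pose b j := if j == 1%N then 1 else a j.
rewrite mulrBr -(mulr1 (4 * _ ^+ 2 - 1)).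
have -> : n.+1%:R / 2 * ((4 * y ^+ 2 - 1) * 1) =
  (4 * y ^+ 2 - 1) * (n.+1%:R / 2 * b 1%N) by rewrite /b /=; ring.
have -> : a 3 = b 3 by [].
rewrite -!(sine_sum_coef (N := N)); [|lia..].
rewrite mulr_sumr -sumrB; apply: eq_bigr => k _.
by rewrite sine_polyE 1?(leq_trans _ N3) // sin3 mul1r; ring.
Qed.

End SineSums.

(** * Gauss and Gauss-Lobatto quadrature *)

Section Quadrature.
Set Implicit Arguments.
Unset Strict Implicit.
Variable R : realType.
Local Notation U := (chebyshevU R).
Implicit Types (f g p : {poly R}) (x y : R).

(** Used to pass to the endpoints of [-1, 1] and from the open disc to the unit circle. *)
Lemma horner_ge0_adherent p x :
  (forall d, 0 < d -> exists2 u, `|u - x| < d & 0 <= p.[u]) -> 0 <= p.[x].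
Proof.
move=> adh; rewrite leNgt; apply/negP => px0.
have [|d d0 pd] := @poly_cont _ x p (- p.[x]); first by rewrite oppr_gt0.
have [u ux pu0] := adh d d0.
by have := pd u ux; rewrite ltr_norml => /andP[_]; lra.
Qed.

(** The Gauss quadrature for the weight sqrt(1 - x^2), left unnormalized: the total weight is (n +
    1) / 2 for n > 0. *)
Definition gaussU n f : R :=
  \sum_(k < n.+1) sin (node R n k) ^+ 2 * f.[cos (node R n k)].

Lemma gaussU_ge0 n f :
  (forall x, -1 <= x <= 1 -> 0 <= f.[x]) -> 0 <= gaussU n f.
Proof.
move=> f0; apply: sumr_ge0 => k _; rewrite mulr_ge0 ?sqr_ge0 //.
by apply: f0; rewrite cos_geN1 cos_le1.
Qed.

Lemma gaussUD n f g : gaussU n (f + g) = gaussU n f + gaussU n g.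
Proof.
by rewrite -big_split; apply: eq_bigr => k _; rewrite hornerD mulrDr.
Qed.

Lemma gaussUZ n c f : gaussU n (c *: f) = c * gaussU n f.
Proof.
by rewrite mulr_sumr; apply: eq_bigr => k _; rewrite hornerZ mulrCA.
Qed.

Lemma gaussU_sum n (s : seq R) (F : R -> {poly R}) :
  gaussU n (\sum_(x <- s) F x) = \sum_(x <- s) gaussU n (F x).
Proof.
rewrite exchange_big; apply: eq_bigr => k _.
by rewrite horner_sum mulr_sumr.
Qed.

(** Each factor cos t replaces sin(it) by half the sum of its two neighbouring frequencies, so all
    frequencies stay below n and are orthogonal to sin(nt). *)
Lemma sin_node_cosX n i j : (i + j < n)%N ->
  \sum_(k < n.+1) sin (n%:R * node R n k) *
    (sin (i%:R * node R n k) * cos (node R n k) ^+ j) = 0.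
Proof.
elim: j i => [|j IH] i ijn.
  under eq_bigr do rewrite expr0 mulr1.
  rewrite sine_orthogonality; [|lia..].
  by rewrite gtn_eqF ?mul0r //; lia.
case: i ijn => [|i] ijn.
  by rewrite big1 // => k _; rewrite mul0r sin0 mul0r mulr0.
transitivity ((\sum_(k < n.+1) sin (n%:R * node R n k) *
    (sin (i.+2%:R * node R n k) * cos (node R n k) ^+ j) +
  \sum_(k < n.+1) sin (n%:R * node R n k) *
    (sin (i%:R * node R n k) * cos (node R n k) ^+ j)) / 2).
  rewrite -big_split mulr_suml; apply: eq_bigr => k _ /=.
  set t := node R n k.
  have -> : i.+2%:R * t = i.+1%:R * t + t by rewrite -(natr1 i.+1); ring.
  have -> : i%:R * t = i.+1%:R * t - t by rewrite -(natr1 i); ring.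
  by rewrite exprS sinD sinB; field.
by rewrite !IH ?addr0 ?mul0r //; lia.
Qed.

(** At a node sin((n + 1)t) = 0, hence sin^3 t U_n'(cos t) = (n + 1) sin(nt). The summand becomes
    sin(nt) times sin t g(cos t), whose frequencies are below n. *)
Lemma gaussU_deriv_orthogonal n g : (size g < n)%N ->
  gaussU n ((1 - 'X^2) * (U n)^`() * g) = 0.
Proof.
move=> gn.
transitivity (n.+1%:R * \sum_(k < n.+1) sin (n%:R * node R n k) *
    (sin (1 * node R n k) * g.[cos (node R n k)])).
  rewrite mulr_sumr; apply: eq_bigr => k _; set t := node R n k.
  have UE := deriv_chebyshevU_cos n t.
  have snt : sin (n.+1%:R * t) = 0 by exact: sin_node.
  have sE : sin (n.+2%:R * t) = - sin (n%:R * t).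
    have -> : n.+2%:R * t = n.+1%:R * t + t by rewrite -(natr1 n.+1); ring.
    have -> : n%:R * t = n.+1%:R * t - t by rewrite -(natr1 n); ring.
    by rewrite sinD sinB snt; ring.
  have {}UE : sin t ^+ 3 * (U n)^`().[cos t] = n.+1%:R * sin (n%:R * t).
    have two0 : (2 : R) != 0 by rewrite pnatr_eq0.
    by apply: (mulfI two0); rewrite mulrA UE sE -!natr1; ring.
  rewrite !(hornerM, hornerD, hornerN, hornerXn, hornerX, hornerC) mul1r -expr2.
  have -> : 1 - cos t ^+ 2 = sin t ^+ 2 by have := cos2Dsin2 t; lra.
  transitivity (sin t * (sin t ^+ 3 * (U n)^`().[cos t]) * g.[cos t]).
    by ring.
  by rewrite UE; ring.
under eq_bigr do rewrite horner_coef !mulr_sumr.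
rewrite exchange_big big1 ?mulr0 //= => j _.
rewrite (eq_bigr (fun k : 'I_n.+1 => g`_j * (sin (n%:R * node R n k) *
   (sin (1%:R * node R n k) * cos (node R n k) ^+ j)))); last first.
  by move=> k _; ring.
rewrite -mulr_sumr sin_node_cosX ?mulr0 // add1n.
exact: leq_ltn_trans (ltn_ord j) gn.
Qed.

(** Rolle's theorem between consecutive zeros of U_n. The zeros found interlace those of U_n, hence
    are distinct, and their number is the degree of U_n', so there are no others. *)
Lemma deriv_chebyshevU_roots n : exists s : seq R,
  [/\ size s = n.-1, uniq s, all (root (U n)^`()) s
    & forall x, x \in s -> -1 < x < 1].
Proof.
pose a k : R := cos (node R n k.+1).
have pi0 := pi_gt0 R.
have adec k l : (k < l < n)%N -> a l < a k.
  move=> /andP[kl ln]; rewrite /a ltr_cos ?in_itv /= ?node_itv //; last lia.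
  by rewrite /node ltr_pM2r ?divr_gt0 ?ltr0n // ltr_nat.
have aroot k : (k < n)%N -> (U n).[a k] = 0.
  move=> kn; have s0 : sin (node R n k.+1) != 0.
    by rewrite gt_eqF // sin_gt0_pi // node_itv_oo.
  by apply: (mulIf s0); rewrite chebyshevU_cos sin_node mul0r.
have /choice[xi xiP] : forall k, exists x, (k.+1 < n)%N ->
    [/\ a k.+1 < x, x < a k & (U n)^`().[x] = 0].
  (* Beyond the last gap the value 0 is a dummy, needed only for choice over all [k]. *)
  move=> k; case: (ltnP k.+1 n) => kn; last by exists 0.
  have ak : a k.+1 < a k by apply: adec; rewrite ltnSn.
  have [|c] := poly_rolle ak (p := U n); first by rewrite !aroot // ltnW.
  by rewrite in_itv /= => /andP[? ?] c0; exists c.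
have xidec k l : (k < l)%N -> (l.+1 < n)%N -> xi l < xi k.
  move=> kl ln; have [_ xl _] := xiP l ln.
  have [xk _ _] := xiP k (leq_ltn_trans kl (ltnW ln)).
  apply: lt_trans xl (le_lt_trans _ xk).
  have [->//|lk] := eqVneq l k.+1.
  by rewrite ltW // adec //; lia.
exists [seq xi k | k <- iota 0 n.-1]; split.
- by rewrite size_map size_iota.
- rewrite map_inj_in_uniq ?iota_uniq // => k l; rewrite !mem_iota => kn ln E.
  case: (ltngtP k l) => // kl.
    by have := xidec k l kl; rewrite E ltxx => /(_ ltac:(lia)).
  by have := xidec l k kl; rewrite E ltxx => /(_ ltac:(lia)).
- apply/allP => x /mapP[k]; rewrite mem_iota => kn ->.
  by have [|_ _ /eqP] := xiP k; first lia.
- move=> x /mapP[k]; rewrite mem_iota => kn ->.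
  have [|x1 x2 _] := xiP k; first lia.
  by rewrite (lt_le_trans x2 (cos_le1 _)) (le_lt_trans (cos_geN1 _) x1).
Qed.

(* Integrating [F x] shows that the weight of the Gauss-Lobatto quadrature at
   the node [x] is nonnegative. *)
Lemma lobatto_basis n (s : seq R) : (0 < n)%N -> size s = n.-1 -> uniq s ->
  (forall x, x \in s -> -1 < x < 1) ->
  exists F : R -> {poly R}, forall x, x \in [:: 1, -1 & s] ->
    [/\ (size (F x) <= n.*2)%N, forall z, -1 <= z <= 1 -> 0 <= (F x).[z],
        0 < (F x).[x]
      & forall z, z \in [:: 1, -1 & s] -> z != x -> (F x).[z] = 0].
Proof.
move=> n0 sn us sI.
pose D : {poly R} := \prod_(z <- s) ('X - z%:P).
pose Dx x : {poly R} := \prod_(z <- rem x s) ('X - z%:P).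
have n1s : 1 \notin s by apply/negP => /sI; rewrite ltxx andbF.
have nN1s : -1 \notin s by apply/negP => /sI; rewrite ltxx.
have n11 : (1 : R) != -1 by rewrite -subr_eq0 opprK -mulr2n pnatr_eq0.
(* The square of the product over the other interior nodes is multiplied by whichever of 1 + X, 1 -
   X, 1 - X^2 kills the remaining endpoints. All three are nonnegative on [-1, 1], and the degree
   stays below 2n. *)
pose F x : {poly R} := if x == 1 then (1 + 'X) * D ^+ 2 else
  if x == -1 then (1 - 'X) * D ^+ 2 else (1 - 'X^2) * Dx x ^+ 2.
pose ns := [:: 1, -1 & s].
have szD : size D = n by rewrite size_prod_XsubC sn prednK.
have Dnz x : (D.[x] == 0) = (x \in s) by rewrite -root_prod_XsubC.
have Dxnz x z : ((Dx x).[z] == 0) = (z \in rem x s).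
  by rewrite -root_prod_XsubC.
have szD2 : (size (D ^+ 2) <= n.*2.-1)%N.
  by apply: leq_trans (size_poly_exp_leq D 2) _; rewrite szD; lia.
have szF x : x \in ns -> (size (F x) <= n.*2)%N.
  move=> xns; rewrite /F; case: ifP => x1; last case: ifP => xN1.
  - rewrite (leq_trans (size_polyMleq _ _)) // addrC size_XaddC.
    by apply: leq_ltn_trans szD2 _; lia.
  - rewrite -opprB mulNr size_polyN (leq_trans (size_polyMleq _ _)) //.
    rewrite (_ : size ('X - 1 : {poly R}) = 2%N); last exact: size_XsubC.
    by apply: leq_ltn_trans szD2 _; lia.
  - have xs : x \in s by move: xns; rewrite !inE x1 xN1.
    rewrite -opprB mulNr size_polyN (leq_trans (size_polyMleq _ _)) //.
    rewrite (_ : size ('X^2 - 1 : {poly R}) = 3%N); last exact: size_XnsubC.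
    have s0 : (0 < size s)%N by case: (s) xs.
    have szDx2 : (size (Dx x ^+ 2) <= n.*2.-2)%N.
      apply: leq_trans (size_poly_exp_leq (Dx x) 2) _.
      by move: s0; rewrite size_prod_XsubC size_rem // sn => s0; lia.
    by apply: (@leq_trans n.*2.-2.+2); [exact: szDx2 | lia].
have F0 x z : -1 <= z <= 1 -> 0 <= (F x).[z].
  move=> /andP[z1 z2]; rewrite /F; case: ifP => _; last case: ifP => _;
    rewrite !(horner_exp, hornerX, hornerC, hornerD, hornerN, hornerM).
  - by rewrite mulr_ge0 ?sqr_ge0 //; lra.
  - by rewrite mulr_ge0 ?sqr_ge0 //; lra.
  - by rewrite mulr_ge0 ?sqr_ge0 //; nra.
have Fx x : x \in ns -> 0 < (F x).[x].
  move=> xns; have xI : -1 <= x <= 1.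
    move: xns; rewrite !inE => /or3P[/eqP->|/eqP->|/sI /andP[]].
    - by rewrite lexx andbT; lra.
    - by rewrite lexx; lra.
    - by move=> *; rewrite !ltW.
  rewrite lt_def F0 // andbT /F; case: ifP => [/eqP->|x1];
    last case: ifP => [/eqP->|xN1];
    rewrite !(horner_exp, hornerX, hornerC, hornerD, hornerN, hornerM).
  - by rewrite mulf_neq0 ?sqrf_eq0 ?Dnz // -mulr2n pnatr_eq0.
  - by rewrite mulf_neq0 ?sqrf_eq0 ?Dnz // opprK -mulr2n pnatr_eq0.
  - rewrite mulf_neq0 ?sqrf_eq0 ?Dxnz ?mem_rem_uniq ?inE ?eqxx //.
    by rewrite subr_eq0 eq_sym sqrf_eq1 x1 xN1.
have Fz x z : x \in ns -> z \in ns -> z != x -> (F x).[z] = 0.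
  move=> xns zns zx; apply/eqP; rewrite /F.
  case: ifP => [/eqP x1|x1]; last case: ifP => [/eqP xN1|xN1];
    rewrite !(horner_exp, hornerX, hornerC, hornerD, hornerN, hornerM);
    move: zns; rewrite !inE => /or3P[/eqP z1|/eqP z1|zs].
  - by rewrite z1 x1 eqxx in zx.
  - by rewrite z1 subrr mul0r.
  - by move: zs; rewrite -Dnz => /eqP ->; rewrite expr0n mulr0.
  - by rewrite z1 subrr mul0r.
  - by rewrite z1 xN1 eqxx in zx.
  - by move: zs; rewrite -Dnz => /eqP ->; rewrite expr0n mulr0.
  - by rewrite z1 expr1n subrr mul0r.
  - by rewrite z1 sqrrN expr1n subrr mul0r.
  - have : z \in rem x s by rewrite mem_rem_uniq // inE zx.
    by rewrite -Dxnz => /eqP ->; rewrite expr0n mulr0.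
exists F => x xns; split; [exact: szF|exact: F0|exact: Fx|].
by move=> z; apply: Fz.
Qed.

(* Gauss-Lobatto quadrature for the weight of the U_j: the nodes are -1, 1 and
   the zeros of U_n'. *)
Lemma lobatto_ge0 n f : (0 < n)%N -> (size f <= n.*2)%N ->
  (forall x, -1 <= x <= 1 -> x \in [:: 1; -1] \/ root (U n)^`() x ->
     0 <= f.[x]) ->
  0 <= gaussU n f.
Proof.
move=> n0 fn f0; have [s [sn us rs sI]] := deriv_chebyshevU_roots n.
have [F FP] := lobatto_basis n0 sn us sI.
pose D : {poly R} := \prod_(z <- s) ('X - z%:P).
pose ns := [:: 1, -1 & s].
have n1s : 1 \notin s by apply/negP => /sI; rewrite ltxx andbF.
have nN1s : -1 \notin s by apply/negP => /sI; rewrite ltxx.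
have n11 : (1 : R) != -1 by rewrite -subr_eq0 opprK -mulr2n pnatr_eq0.
have uns : uniq ns by rewrite /= inE negb_or n11 n1s nN1s us.
have szF x : x \in ns -> (size (F x) <= n.*2)%N by case/FP.
have F0 x z : x \in ns -> -1 <= z <= 1 -> 0 <= (F x).[z].
  by case/FP => _ F0 _ _; apply: F0.
have Fx x : x \in ns -> 0 < (F x).[x] by case/FP.
have Fz x z : x \in ns -> z \in ns -> z != x -> (F x).[z] = 0.
  by case/FP => _ _ _; apply.
pose c x := f.[x] / (F x).[x].
(* [r] interpolates [f] at the Lobatto nodes, and its coefficients [c x] are nonnegative by the
   hypothesis on [f]. *)
pose r := \sum_(x <- ns) c x *: F x.
have rx x : x \in ns -> r.[x] = f.[x].
  move=> xns; rewrite /r horner_sum (bigD1_seq x) //= big_seq_cond big1.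
    by rewrite addr0 hornerZ /c divfK // gt_eqF // Fx.
  by move=> z /andP[zns zx]; rewrite hornerZ Fz ?mulr0 // eq_sym.
have szr : (size r <= n.*2)%N.
  rewrite /r big_seq; apply: (big_ind (fun p : {poly R} => (size p <= n.*2)%N)).
  - by rewrite size_poly0.
  - by move=> p1 p2 h1 h2; rewrite (leq_trans (size_polyD _ _)) // geq_max h1.
  - by move=> x xns; rewrite (leq_trans (size_scale_leq _ _)) // szF.
have rts : all (root (f - r)) ns.
  by apply/allP => x xns; rewrite /root hornerD hornerN rx // subrr.
have [q qE] := uniq_roots_prod_XsubC rts (etrans (uniq_rootsE ns) uns).
set V := (U n)^`().
have UD : V = lead_coef V *: D.
  apply: all_roots_prod_XsubC; rewrite ?uniq_rootsE // sn prednK //.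
  by rewrite polyorder.size_deriv size_chebyshevU.
have l0 : lead_coef V != 0.
  rewrite lead_coef_eq0 -size_poly_eq0 polyorder.size_deriv size_chebyshevU.
  by rewrite -lt0n.
have DE : D = (lead_coef V)^-1 *: V by rewrite {2}UD scalerA mulVf ?scale1r.
(* [f - r] vanishes at the n + 1 nodes, hence is (1 - X^2) U_n' times a quotient of size below [n],
   which [gaussU] annihilates. Only [r] contributes. *)
have fE : f = r + (1 - 'X^2) * V * ((- (lead_coef V)^-1) *: q).
  apply/eqP; rewrite -subr_eq0 opprD addrA qE !big_cons -/D DE -!mul_polyC.
  by apply/eqP; rewrite rmorphN /= rmorph1 ; ring.
rewrite fE gaussUD gaussU_deriv_orthogonal ?addr0; last first.
  rewrite (leq_ltn_trans (size_scale_leq _ _)) //.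
  have [->|q0] := eqVneq q 0; first by rewrite size_poly0.
  have : (size (f - r)%R <= n.*2)%N.
    by rewrite (leq_trans (size_polyD _ _)) // geq_max fn size_polyN.
  rewrite qE size_Mmonic ?monic_prod_XsubC // size_prod_XsubC /= sn.
  set m := size q; lia.
rewrite /r gaussU_sum big_seq; apply: sumr_ge0 => x xns.
rewrite gaussUZ mulr_ge0 ?gaussU_ge0 // /c ?divr_ge0 ?(ltW (Fx _ xns)) //.
  apply: f0; move: xns; rewrite !inE.
    case/or3P => [/eqP->|/eqP->|/sI/andP[? ?]]; last by rewrite !ltW.
      by rewrite lexx andbT; lra.
    by rewrite lexx; lra.
  case/or3P => [->|->|xs]; [by left|by left; rewrite orbT|right].
  exact: (allP rs).
by move=> z; apply: F0.
Qed.

End Quadrature.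

(** * Typically real polynomials *)

Section TypicallyReal.
Set Implicit Arguments.
Unset Strict Implicit.
Variable R : realType.
Local Notation C := R[i].
Local Notation Re := (@complex.Re R).
Local Notation Im := (@complex.Im R).
Local Notation toC := (map_poly (real_complex R)).
Implicit Types (p : {poly R}) (t x y : R) (z u v w : C).

Lemma ImD u v : Im (u + v) = Im u + Im v.
Proof. by case: u; case: v. Qed.

Lemma ImB u v : Im (u - v) = Im u - Im v.
Proof. by case: u; case: v. Qed.

Lemma Im_sum (I : Type) (s : seq I) (P : pred I) (F : I -> C) :
  Im (\sum_(i <- s | P i) F i) = \sum_(i <- s | P i) Im (F i).
Proof. exact: (big_morph Im ImD erefl). Qed.

Lemma ImZ x u : Im (x%:C * u) = x * Im u.
Proof. by case: u => a b /=; rewrite mul0r addr0. Qed.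

Lemma Im_conj u : Im (u^*)%C = - Im u.
Proof. by case: u. Qed.

Lemma norm_real x : `|x%:C| = `|x|%:C.
Proof. by rewrite normc_def /= expr0n addr0 sqrtr_sqr. Qed.

Definition expi t : C := cos t +i* sin t.

Lemma expiD t s : expi (t + s) = expi t * expi s.
Proof.
rewrite /expi cosD sinD; apply/eqP.
by rewrite eq_complex /= [sin t * _ + _]addrC !eqxx.
Qed.

Lemma expi0 : expi 0 = 1.
Proof. by rewrite /expi cos0 sin0. Qed.

Lemma expiX t n : expi t ^+ n = expi (n%:R * t).
Proof.
elim: n => [|n IH]; first by rewrite mul0r expi0.
by rewrite exprS IH -expiD -natr1; congr expi; ring.
Qed.

Lemma norm_lt1 z : `|z| < 1 -> Re z ^+ 2 + Im z ^+ 2 < 1.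
Proof.
rewrite normc_def -[1]/(1%:C) ltcR => z1.
rewrite -[ltLHS]sqr_sqrtr ?addr_ge0 ?sqr_ge0 //.
by rewrite expr_lt1 ?sqrtr_ge0.
Qed.

Lemma Im_le_norm u x : `|u| <= x%:C -> Im u <= x.
Proof.
rewrite normc_def lecR; apply: le_trans; apply: (le_trans (ler_norm _)).
by rewrite -sqrtr_sqr ler_wsqrtr // lerDr sqr_ge0.
Qed.

(** The generating function sin t z / (1 - 2 cos t z + z^2) of the sin(it), truncated: the
    three-term recurrence cancels everything but the boundary terms. *)
Lemma sine_kernel m t z :
  (1 - 2 * (cos t)%:C * z + z ^+ 2) *
    (\sum_(i < m.+1) (sin (i%:R * t))%:C * z ^+ i) =
  (sin t)%:C * z - (sin (m.+1%:R * t))%:C * z ^+ m.+1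
    + (sin (m%:R * t))%:C * z ^+ m.+2.
Proof.
elim: m => [|m IH].
  by rewrite big_ord1 !mul0r sin0 !mul1r mul0r !mulr0 expr1 mul0r subrr addr0.
rewrite big_ord_recr /= mulrDr IH.
have -> : m.+2%:R * t = m.+1%:R * t + t by rewrite -(natr1 m.+1); ring.
have -> : m%:R * t = m.+1%:R * t - t by rewrite -(natr1 m); ring.
by rewrite !sinD sinN cosN !(rmorphD, rmorphN, rmorphM) /= !exprS; ring.
Qed.

(** The product is z - 2x|z|^2 + |z|^2 conj(z). Its imaginary part does not depend on x and is
    positive in the upper half-disc, which is why the untruncated kernel is typically real. *)
Lemma Im_mul_conj_quadratic x z : Im (z * ((1 - 2 * x%:C * z + z ^+ 2)^*)%C) =
  Im z * (1 - Re z ^+ 2 - Im z ^+ 2).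
Proof.
have -> : (2 : C) = 2%:C by rewrite rmorph_nat.
by case: z => a b; rewrite expr2; simpc => /=; ring.
Qed.

(** When sin((m + 1)t) = 0 the kernel is sin t (z - c z^(m+2)) / D with |c| <= 1 and |D| <= 4. After
    multiplication by conj(D), the truncation error is at most 4 r^(m+2), less than the main
    term. *)
Lemma sine_kernel_gt0 m t z r : 0 < sin t -> sin (m.+1%:R * t) = 0 ->
    `|z| = r%:C -> `|z| < 1 ->
    4 * r ^+ m.+2 < Im z * (1 - Re z ^+ 2 - Im z ^+ 2) ->
  0 < Im (\sum_(i < m.+1) (sin (i%:R * t))%:C * z ^+ i).
Proof.
move=> st sm zr z1 zm.
set K := \sum_(i < m.+1) _; set D : C := 1 - 2 * (cos t)%:C * z + z ^+ 2.
pose c := cos (m.+1%:R * t).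
have KE : D * K = (sin t)%:C * (z - c%:C * z ^+ m.+2).
  rewrite sine_kernel sm; have -> : sin (m%:R * t) = - c * sin t.
    have -> : m%:R * t = m.+1%:R * t - t by rewrite -(natr1 m); ring.
    by rewrite sinB sm /c; ring.
  by rewrite rmorphM rmorphN /=; ring.
have c1 : `|c%:C| <= 1.
  rewrite norm_real -[leRHS]/(1%:C) lecR.
  by rewrite ler_norml cos_geN1 cos_le1.
have D4 : `|(D^*)%C| <= 4.
  have x1 : `|(cos t)%:C| <= 1.
    rewrite norm_real -[leRHS]/(1%:C) lecR.
    by rewrite ler_norml cos_geN1 cos_le1.
  rewrite normcJ /D (le_trans (ler_normD _ _)) //.
  have -> : (4 : C) = 1 + 2 * 1 * 1 + 1 by ring.
  apply: lerD; last by rewrite normrX exprn_ile1 // ltW.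
  apply: le_trans (ler_normB _ _) _; rewrite normr1 !normrM; apply: lerD => //.
  rewrite [`|2|]ger0_norm // -!mulrA ler_pM2l //.
  by apply: ler_pM => //; exact: ltW.
have ImzD : Im (z * (D^*)%C) = Im z * (1 - Re z ^+ 2 - Im z ^+ 2).
  exact: Im_mul_conj_quadratic.
have num : 0 < Im ((z - c%:C * z ^+ m.+2) * (D^*)%C).
  rewrite mulrBl ImB ImzD subr_gt0; apply: le_lt_trans zm; apply: Im_le_norm.
  rewrite normrM [`|c%:C * _|]normrM normrX zr rmorphM rmorphXn /= [4%:C]rmorph_nat.
  rewrite mulrC -zr; have := exprn_ge0 m.+2 (normr_ge0 z).
  move: (`|z| ^+ m.+2) => w w0.
  by apply: ler_pM; rewrite ?mulr_ge0 ?normr_ge0 // ler_piMl.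
have D0 : D != 0.
  by apply/eqP => D0; move: num; rewrite D0 conjc0 mulr0 /= ltxx.
pose d := Re D ^+ 2 + Im D ^+ 2.
have dE : d%:C = D * (D^*)%C.
  by rewrite -sqr_normc add_Re2_Im2.
have d0 : 0 < d.
  by rewrite -ltcR dE -sqr_normc exprn_gt0 // normr_gt0.
rewrite -(pmulr_rgt0 _ d0) -ImZ dE.
have -> : D * (D^*)%C * K = (sin t)%:C * ((z - c%:C * z ^+ m.+2) * (D^*)%C).
  by rewrite mulrAC KE; ring.
by rewrite ImZ mulr_gt0.
Qed.

Lemma im_circleE N p t : (size p <= N.+1)%N ->
  im_circle (toC p) t = sine_sum N (nth 0 p) t.
Proof.
move=> pN; rewrite /im_circle (@horner_coef_wide _ N.+1) ?size_map_poly //.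
rewrite Im_sum; apply: eq_bigr => i _.
by rewrite coef_map -/(expi t) expiX ImZ.
Qed.

(* For m large, p.[z] is a combination, with the nonnegative coefficients
   S(t_k), of kernels of positive imaginary part, where S = im_circle p and
   t_k = k pi / (m + 1). *)
Lemma typically_real_gt0 p z :
    p`_0 = 0 -> p`_1 = 1 ->
    (forall t, 0 <= t <= pi -> 0 <= im_circle (toC p) t) ->
  `|z| < 1 -> 0 < Im z -> 0 < Im (toC p).[z].
Proof.
move=> p0 p1 S0 z1 Iz0.
have zz := norm_lt1 z1.
pose r := Num.sqrt (Re z ^+ 2 + Im z ^+ 2).
have zr : `|z| = r%:C by rewrite normc_def.
(* Any [m] with [size p <= m.+1] represents [p] at the nodes, so [m] may be taken large enough,
   depending on z, for the truncation error to be negligible. *)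
have [m [pm m0 mz]] : exists m, [/\ (size p <= m.+1)%N, (0 < m)%N &
    4 * r ^+ m.+2 < Im z * (1 - Re z ^+ 2 - Im z ^+ 2)].
  pose e := Im z * (1 - Re z ^+ 2 - Im z ^+ 2) / 4.
  have e0 : 0 < e by rewrite divr_gt0 // mulr_gt0 // -addrA -opprD subr_gt0.
  have r1 : `|r| < 1.
    by rewrite ger0_norm ?sqrtr_ge0 // -ltcR -zr.
  have /cvgrPdist_lt /(_ e e0)[M _ HM] := cvg_expr r1.
  exists (M + size p).+1; split => //; first lia.
  have : (M <= (M + size p).+3)%N by lia.
  move=> /HM /=; rewrite sub0r normrN; have := ler_norm (r ^+ (M + size p).+3).
  rewrite /e; lra.
have pE i : (i < m.+1)%N ->
    \sum_(k < m.+1) sin (i%:R * node R m k) * im_circle (toC p) (node R m k) =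
    m.+1%:R / 2 * p`_i.
  move=> im; case: (posnP i) => [->|i0].
    by rewrite p0 mulr0 big1 // => k _; rewrite mul0r sin0 mul0r.
  under eq_bigr do rewrite (im_circleE _ pm).
  by rewrite sine_sum_coef //; lia.
have PE : (m.+1%:R / 2)%:C * (toC p).[z] = \sum_(k < m.+1)
    (im_circle (toC p) (node R m k))%:C *
      \sum_(i < m.+1) (sin (i%:R * node R m k))%:C * z ^+ i.
  rewrite (@horner_coef_wide _ m.+1) ?size_map_poly // mulr_sumr.
  under [RHS]eq_bigr do rewrite mulr_sumr.
  rewrite exchange_big; apply: eq_bigr => i _ /=.
  rewrite coef_map /= mulrA -rmorphM /= -pE // rmorph_sum mulr_suml.
  by apply: eq_bigr => k _; rewrite rmorphM /=; ring.
have m2 : 0 < m.+1%:R / 2 :> R by rewrite divr_gt0 ?ltr0n.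
rewrite -(pmulr_rgt0 _ m2) -ImZ PE Im_sum.
pose K (k : 'I_m.+1) : C := \sum_(i < m.+1) (sin (i%:R * node R m k))%:C * z ^+ i.
have K0 (k : 'I_m.+1) : (0 < k)%N -> 0 < Im (K k).
  move=> k0; apply: (sine_kernel_gt0 _ _ zr) => //; last exact: sin_node.
  by rewrite sin_gt0_pi // node_itv_oo // k0 /=.
have S0k (k : 'I_m.+1) : 0 <= im_circle (toC p) (node R m k).
  by apply: S0; exact: node_itv.
have K0' (k : 'I_m.+1) :
    0 <= im_circle (toC p) (node R m k) * Im (K k).
  have [k0|k0] := posnP k; last by rewrite mulr_ge0 // ltW // K0.
  by rewrite (im_circleE _ pm) k0 /sine_sum big1 ?mul0r // => i _;
     rewrite /node mul0r mulr0 sin0 mulr0.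
under eq_bigr do rewrite ImZ.
rewrite lt_def sumr_ge0 ?andbT; last by move=> k _; exact: K0'.
(* Strictness: if the sum were 0, S would vanish at all nodes, contradicting the recovery of p_1 = 1
   from these values. *)
apply/negP; rewrite psumr_eq0; last by move=> k _; exact: K0'.
move=> /allP h; have := pE 1%N; rewrite ltnS m0 p1 mulr1 big1.
  by move=> /(_ erefl) E; rewrite -E ltxx in m2.
move=> k _; rewrite mul1r; apply/eqP; rewrite mulf_eq0.
have [k0|k0] := posnP k.
  by rewrite k0 /node mul0r sin0 eqxx.
have := h k (mem_index_enum _); rewrite implyTb mulf_eq0.
by rewrite (gt_eqF (K0 k k0)) orbF => ->; rewrite orbT.
Qed.

(** Real coefficients make p commute with conjugation, which settles the real axis and carries the
    upper half-disc to the lower one. *)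
Lemma typically_real_of_nonneg p :
    p`_0 = 0 -> p`_1 = 1 ->
    (forall t, 0 <= t <= pi -> 0 <= im_circle (toC p) t) ->
  typically_real (horner (toC p)).
Proof.
move=> p0 p1 S0.
have conjP z : (toC p).[(z^*)%C] = ((toC p).[z]^*)%C.
  rewrite !horner_coef size_map_poly rmorph_sum; apply: eq_bigr => i _.
  by rewrite coef_map rmorphM rmorphXn; congr (_ * _); rewrite /= oppr0.
split=> z z1 zi.
  have zE : (z^*)%C = z by case: z zi {z1} => a b /= ->; rewrite oppr0.
  have := conjP z; rewrite zE => /(congr1 Im); rewrite Im_conj; lra.
case: (ltgtP (Im z) 0) => [Iz|Iz|Iz]; last by rewrite Iz eqxx in zi.
  have : 0 < Im (toC p).[(z^*)%C].
    by apply: typically_real_gt0; rewrite ?normcJ // Im_conj oppr_gt0.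
  by rewrite conjP Im_conj => h; rewrite -mulrNN mulr_gt0 // oppr_gt0.
by apply: mulr_gt0 => //; exact: typically_real_gt0.
Qed.

(** The imaginary parts of the coefficients form a polynomial vanishing on the real diameter, hence
    zero. Nonnegativity on the circle is a radial limit of positivity in the disc. So every bound
    for sine polynomials applies to typically real ones. *)
Lemma typreal_coefs N (P : {poly C}) : typreal_le N P -> (0 < N)%N ->
  exists2 p : {poly R}, P = toC p &
    [/\ (size p <= N.+1)%N, p`_0 = 0, p`_1 = 1 & nonneg_sine_le N (nth 0 p)].
Proof.
move=> [sP P0 P1 [PR PI]] N0.
pose q := \poly_(i < N.+1) Im P`_i; pose p := \poly_(i < N.+1) Re P`_i.
have qE x : q.[x] = Im P.[x%:C].
  rewrite horner_poly (horner_coef_wide _ sP) Im_sum; apply: eq_bigr => i _.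
  by rewrite -rmorphXn mulrC /= [_ * _%:C]mulrC ImZ.
have q0 : q = 0.
  apply/eqP/negP => /negP q0.
  (* As many distinct points of (0, 1) as the size of [q], one more than a nonzero [q] can have as
     roots. *)
  pose s : seq R := [seq (k.+2%:R)^-1 | k <- iota 0 (size q)].
  have qs : all (root q) s.
    apply/allP => x /mapP[k _ ->]; rewrite /root qE; apply/eqP/PR => //.
    rewrite norm_real -[ltRHS]/(1%:C) ltcR.
    by rewrite ger0_norm ?invr_ge0 // invf_lt1 // ltr1n.
  have us : uniq s.
    rewrite map_inj_uniq ?iota_uniq // => k l /invr_inj /eqP.
    by rewrite eqr_nat => /eqP[].
  by have := max_poly_roots q0 qs us; rewrite size_map size_iota ltnn.
have PE : P = toC p.
  apply/polyP => i; rewrite coef_map coef_poly.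
  have := congr1 (fun r : {poly R} => r`_i) q0; rewrite coef_poly coef0.
  case: ltnP => iN.
    by case: P`_i => a b /= ->.
  by move=> _; rewrite nth_default // (leq_trans sP).
exists p => //.
have p0 : p`_0 = 0 by rewrite coef_poly P0.
have p1 : p`_1 = 1 by rewrite coef_poly P1 ltnS N0.
have ps : (size p <= N.+1)%N by exact: size_poly.
split=> // t /andP[t0 tpi].
have SE : sine_poly N (nth 0 p) t = sine_sum N (nth 0 p) t.
  rewrite sine_polyE //; apply: eq_bigr => j _; case: eqP => // ->.
  by rewrite p1.
rewrite SE.
have [->|tn0] := eqVneq t 0.
  by rewrite /sine_sum big1 // => j _; rewrite mulr0 sin0 mulr0.
have [->|tnpi] := eqVneq t pi.
  by rewrite /sine_sum big1 // => j _; rewrite sin_natpi mulr0.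
have st : 0 < sin t by rewrite sin_gt0_pi // !lt_def tn0 t0 eq_sym tnpi.
(* Im P along the ray of angle t, as a polynomial in the radius; its value at 1 is the sine sum. *)
pose h := \poly_(i < N.+1) (p`_i * sin (i%:R * t)).
have hE x : h.[x] = Im P.[x%:C * expi t].
  rewrite horner_poly PE (@horner_coef_wide _ N.+1) ?size_map_poly // Im_sum.
  apply: eq_bigr => i _; rewrite coef_map /= exprMn expiX -rmorphXn mulrA.
  by rewrite -rmorphM ImZ /=; ring.
have -> : sine_sum N (nth 0 p) t = h.[1].
  by rewrite horner_poly; apply: eq_bigr => i _; rewrite expr1n mulr1.
apply: horner_ge0_adherent => d d0.
pose x := Num.max (1 / 2) (1 - d / 2) : R.
have x0 : 0 < x by rewrite lt_max; apply/orP; left; lra.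
have x1 : x < 1 by rewrite gt_max; apply/andP; split; lra.
have xd : 1 - d / 2 <= x by rewrite le_max lexx orbT.
exists x; first by rewrite distrC gtr0_norm; lra.
rewrite hE ltW // -(pmulr_lgt0 _ (mulr_gt0 x0 st)).
have -> : x * sin t = Im (x%:C * expi t) by rewrite ImZ.
apply: PI; last by rewrite ImZ gt_eqF // mulr_gt0.
rewrite normrM norm_real normc_def /= cos2Dsin2 sqrtr1 mulr1.
by rewrite gtr0_norm // -[ltRHS]/(1%:C) ltcR.
Qed.

End TypicallyReal.

(** * Bounds on the third coefficient *)

Section Bounds.
Set Implicit Arguments.
Unset Strict Implicit.
Variable R : realType.
Local Notation U := (chebyshevU R).
Implicit Types (x y t : R) (a : nat -> R) (n N : nat).

Lemma root_node n k : (0 < k < n.+1)%N -> root (U n) (cos (node R n k)).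
Proof.
move=> kn; have s0 : sin (node R n k) != 0.
  by rewrite gt_eqF // sin_gt0_pi // node_itv_oo.
by apply/eqP/(mulIf s0); rewrite chebyshevU_cos sin_node mul0r.
Qed.

Lemma max_root_itv n y : (1 < n)%N -> is_max_root (U n) y -> 0 < y < 1.
Proof.
move=> n1 [yr ymax]; apply/andP; split.
  apply: (@lt_le_trans _ _ (cos (node R n 1))); last first.
    by apply: ymax; apply: root_node; apply/andP; split=> //; exact: ltnW.
  have pi0 := pi_gt0 R; apply: cos_gt0_pihalf; rewrite /node mul1r.
  rewrite ltr_pM2l // ltf_pV2 ?posrE ?ltr0n // ltr_nat ltnS n1 andbT.
  by rewrite (@lt_trans _ _ 0) ?divr_gt0 ?oppr_lt0 ?divr_gt0 ?ltr0n.
rewrite ltNge; apply/negP => y1.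
by have := chebyshevU_gt0 n y1; rewrite (eqP yr) ltxx.
Qed.

Lemma max_root_sqr_le n y x :
  is_max_root (U n) y -> root (U n) x -> x ^+ 2 <= y ^+ 2.
Proof.
move=> [yr ymax] xr; have := ymax _ xr.
have : - x <= y by apply: ymax; rewrite root_chebyshevUN.
by move=> *; nra.
Qed.

Lemma min_pos_root_sqr_ge (p : {poly R}) y x :
    (forall u, root p (- u) = root p u) -> is_min_pos_root p y ->
  x != 0 -> root p x -> y ^+ 2 <= x ^+ 2.
Proof.
move=> pN [y0 yr ymin] x0 xr.
have [xn|xp|xe] := ltgtP x 0; last by rewrite xe eqxx in x0.
  have : y <= - x by apply: ymin; rewrite ?oppr_gt0 // pN.
  by move=> ?; nra.
have : y <= x by apply: ymin.
by move=> ?; nra.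
Qed.

Lemma min_pos_root_itv n y : (1 < n)%N -> is_min_pos_root (U n) y -> 0 < y < 1.
Proof.
move=> n1 [y0 yr _]; rewrite y0 ltNge; apply/negP => y1.
by have := chebyshevU_gt0 n y1; rewrite (eqP yr) ltxx.
Qed.

Lemma min_pos_root_deriv_itv n y : (1 < n)%N ->
  is_min_pos_root (U n)^`() y -> 0 < y < 1.
Proof.
move=> n1 [y0 yr _]; rewrite y0 /=.
have [s [sn us rs sI]] := deriv_chebyshevU_roots R n.
have sz : size (U n)^`() = (size s).+1.
  by rewrite polyorder.size_deriv size_chebyshevU sn prednK // ltnW.
have V0 : (U n)^`() != 0 by rewrite -size_poly_eq0 sz.
have /sI /andP[] // : y \in s.
rewrite -[y \in s]root_prod_XsubC; move: yr.
rewrite {1}(all_roots_prod_XsubC sz rs (etrans (uniq_rootsE s) us)).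
by rewrite rootZ // lead_coef_eq0.
Qed.

Lemma sine_poly_gaussU_le N n a y : (3 <= N)%N -> (N + 3 < n.+1.*2)%N ->
    nonneg_sine_le N a -> (forall x, root (U n) x -> x ^+ 2 <= y ^+ 2) ->
  a 3%N <= 4 * y ^+ 2 - 1.
Proof.
move=> N3 Nn a0 yx; rewrite -subr_le0.
have n2 : 0 < n.+1%:R / 2 :> R by rewrite divr_gt0 ?ltr0n.
rewrite -(pmulr_rle0 _ n2) -(sine_a3 a y N3 Nn); apply: sumr_le0 => k _.
have [->|k0] := posnP k; first by rewrite /node mul0r sin0 mul0r mulr0.
have kn : (0 < k < n.+1)%N by rewrite k0 /=.
have h : cos (node R n k) ^+ 2 - y ^+ 2 <= 0.
  by rewrite subr_le0 yx // root_node.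
have /andP[t0 tpi] := node_itv_oo R kn.
apply: mulr_le0_ge0; first by rewrite mulr_ge0_le0.
apply: mulr_ge0; first by rewrite sin_ge0_pi // !ltW.
by apply: a0; rewrite !ltW.
Qed.

Lemma sine_poly_gaussU_ge N n a y : (3 <= N)%N -> (N + 3 < n.+1.*2)%N ->
    nonneg_sine_le N a -> (forall x, root (U n) x -> y ^+ 2 <= x ^+ 2) ->
  4 * y ^+ 2 - 1 <= a 3%N.
Proof.
move=> N3 Nn a0 yx; rewrite -subr_ge0.
have n2 : 0 < n.+1%:R / 2 :> R by rewrite divr_gt0 ?ltr0n.
rewrite -(pmulr_rge0 _ n2) -(sine_a3 a y N3 Nn); apply: sumr_ge0 => k _.
have [->|k0] := posnP k; first by rewrite /node mul0r sin0 mul0r mulr0.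
have kn : (0 < k < n.+1)%N by rewrite k0 /=.
have := yx _ (root_node kn); rewrite -subr_ge0 => h.
have /andP[t0 tpi] := node_itv_oo R kn.
apply: mulr_ge0; first by rewrite mulr_ge0.
apply: mulr_ge0; first by rewrite sin_ge0_pi // !ltW.
by apply: a0; rewrite !ltW.
Qed.

(** The terms of [sine_a3] need not have a common sign here, since [y] is compared with the zeros of
    U_n' and not of U_n. The sum is therefore read as the Gauss sum of f = (X^2 - y^2) q, and
    [lobatto_ge0] tests f at the zeros of U_n' and at 1 and -1, where y^2 <= 1 suffices. *)
Lemma sine_poly_lobatto_ge N n a y : (3 <= N)%N -> (N + 3 < n.+1.*2)%N ->
    (N + 2 <= n.*2)%N ->
    nonneg_sine_le N a -> y ^+ 2 <= 1 ->
    (forall x, root (U n)^`() x -> y ^+ 2 <= x ^+ 2) ->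
  4 * y ^+ 2 - 1 <= a 3%N.
Proof.
move=> N3 Nn Nn2 a0 y1 yx; rewrite -subr_ge0.
have n2 : 0 < n.+1%:R / 2 :> R by rewrite divr_gt0 ?ltr0n.
rewrite -(pmulr_rge0 _ n2) -(sine_a3 a y N3 Nn).
pose b j := if j == 1%N then 1 else a j.
pose q : {poly R} := \sum_(j < N) b j.+1 *: U j.
have qE t : sine_poly N a t = sin t * q.[cos t].
  rewrite sine_polyE; last lia.
  rewrite /sine_sum big_ord_recl mul0r sin0 mulr0 add0r horner_sum mulr_sumr.
  by apply: eq_bigr => j _; rewrite hornerZ mulrCA [sin t * _]mulrC chebyshevU_cos.
have szq : (size q <= N)%N.
  rewrite /q; apply: (big_ind (fun p : {poly R} => (size p <= N)%N)).
  - by rewrite size_poly0.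
  - by move=> p1 p2 h1 h2; rewrite (leq_trans (size_polyD _ _)) // geq_max h1.
  - move=> j _; rewrite (leq_trans (size_scale_leq _ _)) //.
    by rewrite size_chebyshevU.
have q0 x : -1 < x < 1 -> 0 <= q.[x].
  move=> /andP[x1 x2]; pose t := acos x.
  have xE : cos t = x by apply: acosK; rewrite in_itv /= !ltW.
  have t0 : 0 < t by rewrite acos_gt0 // x2 ltW.
  have tpi : t < pi by rewrite acos_ltpi // x1 ltW.
  have st : 0 < sin t by rewrite sin_gt0_pi // t0.
  by rewrite -(pmulr_rge0 _ st) -xE -qE a0 // !ltW.
have q0' x : -1 <= x <= 1 -> 0 <= q.[x].
  move=> /andP[x1 x2]; apply: horner_ge0_adherent => d d0.
  pose e := Num.min (1/2) (d / 2).
  have e0 : 0 < e by rewrite lt_min; apply/andP; split; lra.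
  have e1 : e <= 1 / 2 by rewrite ge_min lexx.
  have ed : e <= d / 2 by rewrite ge_min lexx orbT.
  (* Shrinking towards 0 moves a point of [-1, 1] into the open interval, where q(cos t) = S(t) /
     sin t. *)
  exists (x * (1 - e)).
    have -> : x * (1 - e) - x = - (x * e) by ring.
    have : `|x| <= 1 by rewrite ler_norml x1 x2.
    rewrite normrN normrM (gtr0_norm e0) => x1'.
    by have := normr_ge0 x; nra.
  by apply: q0; apply/andP; split; nra.
pose f := ('X^2 - (y ^+ 2)%:P) * q.
have -> : \sum_(k < n.+1) 4 * (cos (node R n k) ^+ 2 - y ^+ 2) *
   (sin (node R n k) * sine_poly N a (node R n k)) = 4 * gaussU n f.
  rewrite /gaussU mulr_sumr; apply: eq_bigr => k _.
  by rewrite qE /f hornerM hornerD hornerN hornerXn hornerC; ring.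
rewrite mulr_ge0 //; apply: lobatto_ge0; first lia.
  rewrite (leq_trans (size_polyMleq _ _)) //.
  have -> : size ('X^2 - (y ^+ 2)%:P : {poly R}) = 3%N by exact: size_XnsubC.
  by rewrite !addSn add0n /=; apply: leq_trans Nn2; rewrite addn2 !ltnS.
move=> x xI xr; rewrite /f hornerM hornerD hornerN hornerXn hornerC.
rewrite mulr_ge0 ?q0' // subr_ge0; case: xr => [|/yx //].
by rewrite !inE => /orP[] /eqP ->; rewrite ?sqrrN expr1n.
Qed.

End Bounds.

(** * Rational functions and divisibility *)

Section MultipleRoots.
Set Implicit Arguments.
Unset Strict Implicit.
Variable F : fieldType.
Implicit Types (p q : {poly F}) (a b : F).

Lemma dvdp_XsubC_sqr p a :
  p.[a] = 0 -> p^`().[a] = 0 -> ('X - a%:P) ^+ 2 %| p.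
Proof.
move=> /eqP/factor_theorem[q ->].
rewrite derivM derivXsubC mulr1 hornerD hornerM hornerXsubC subrr mulr0 add0r.
by move=> /eqP/factor_theorem[r ->]; rewrite -mulrA -expr2 dvdp_mull.
Qed.

Lemma dvdp_XsubC_cube p a : (2 : F) != 0 ->
  p.[a] = 0 -> p^`().[a] = 0 -> p^`()^`().[a] = 0 -> ('X - a%:P) ^+ 3 %| p.
Proof.
move=> two0 /eqP/factor_theorem[q ->].
rewrite derivM derivXsubC mulr1 hornerD hornerM hornerXsubC subrr mulr0 add0r.
move=> qa; rewrite derivD derivM derivXsubC mulr1 !hornerD hornerM hornerXsubC.
rewrite subrr mulr0 add0r -mulr2n -mulr_natl => /eqP.
rewrite mulf_eq0 (negbTE two0) /= => /eqP q'a.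
by rewrite exprSr dvdp_mul // dvdp_XsubC_sqr.
Qed.

Lemma coprimep_XsubC_exp a b m n : a != b ->
  coprimep (('X - a%:P) ^+ m) (('X - b%:P) ^+ n).
Proof.
move=> ab; rewrite coprimep_expl // coprimep_expr //.
by rewrite coprimep_XsubC root_XsubC eq_sym.
Qed.

End MultipleRoots.

(* In terms of [w = z ^+ 2], the sums G1 + G2 and G3 + G4 are
   [z * num / den] with the following numerators and denominators. *)
Section Fractions.
Set Implicit Arguments.
Unset Strict Implicit.
Variable F : fieldType.
Implicit Types (y z : F) (n : nat).

Definition quad y : {poly F} := 1 + 'X^2 + (2 * (1 - 2 * y ^+ 2)) *: 'X.

(** Here M = 2(n + 1), so that M - 2, M and M + 2 are twice n, n + 1 and n + 2; the powers of 2 are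
    absorbed in the constant 16. *)
Definition num12 n y : {poly F} :=
  (16 * y ^+ 2 * (1 - y ^+ 2) / n.+1%:R) *: ('X^2 * (1 - 'X^(n.+1)))
  + (1 - 'X^2) * quad y.

Definition den12 y : {poly F} := (1 - 'X) * quad y ^+ 2.

Definition num34 n y : {poly F} :=
  (- 16 * y ^+ 2 * (1 - y ^+ 2) / (n%:R * n.+1%:R * n.+2%:R)) *:
    ('X^3 * (n.+2%:R ^+ 2 *: (1 - 'X^n) + n%:R ^+ 2 *: (1 - 'X^(n.+2))
             - (2 * n%:R * n.+2%:R) *: ('X - 'X^(n.+1))))
  + (1 - 'X^2) * (1 + 'X^4 - gamma1 y *: ('X + 'X^3)
                  + gamma2 n.+1.*2 y *: 'X^2).

Definition den34 y : {poly F} := (1 - 'X) ^+ 3 * quad y ^+ 2.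

Lemma horner_quad y w : (quad y).[w] = 1 + w ^+ 2 + 2 * (1 - 2 * y ^+ 2) * w.
Proof. by rewrite !(hornerC, hornerXn, hornerX, hornerZ, hornerD). Qed.

Lemma quad_quartic y z : (quad y).[z ^+ 2] = quartic z y.
Proof. by rewrite horner_quad /quartic; ring. Qed.

Lemma quad_deriv y : (quad y)^`() = 2 *: 'X + (2 * (1 - 2 * y ^+ 2))%:P.
Proof.
rewrite /quad !derivD derivC derivXn derivZ derivX add0r expr1 alg_polyC.
by rewrite scaler_nat.
Qed.

Lemma num12_horner n y w : (num12 n y).[w] =
  16 * y ^+ 2 * (1 - y ^+ 2) / n.+1%:R * (w ^+ 2 * (1 - w ^+ n.+1))
  + (1 - w ^+ 2) * (quad y).[w].
Proof.
by rewrite /num12 !(hornerC, hornerXn, hornerX, hornerZ, hornerD, hornerN, hornerM).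
Qed.

Lemma num12_deriv_horner n y w : (num12 n y)^`().[w] =
  16 * y ^+ 2 * (1 - y ^+ 2) / n.+1%:R *
    (2 * w * (1 - w ^+ n.+1) - w ^+ 2 * (n.+1%:R * w ^+ n))
  - 2 * w * (quad y).[w] + (1 - w ^+ 2) * (2 * w + 2 * (1 - 2 * y ^+ 2)).
Proof.
rewrite /num12; move: (16 * _ * _ / _) => k.
rewrite derivD derivZ [('X^2 * _)^`()]derivM [((1 - _) * _)^`()]derivM.
rewrite quad_deriv !derivB !derivXn derivC.
rewrite !(hornerC, hornerXn, hornerX, hornerZ, hornerMn, hornerD, hornerN, hornerM).
by rewrite /= expr1 -[w *+ 2]mulr_natl -[_ *+ n.+1]mulr_natl; ring.
Qed.

Lemma den12_horner y w : (den12 y).[w] = (1 - w) * (quad y).[w] ^+ 2.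
Proof.
by rewrite /den12 !(horner_exp, hornerC, hornerX, hornerD, hornerN, hornerM).
Qed.

Lemma den12_deriv_horner y w : (den12 y)^`().[w] =
  - (quad y).[w] ^+ 2 +
  (1 - w) * (2 * (quad y).[w] * (2 * w + 2 * (1 - 2 * y ^+ 2))).
Proof.
rewrite /den12 expr2 !derivM quad_deriv derivB derivX derivC.
by rewrite !(hornerC, hornerX, hornerZ, hornerD, hornerN, hornerM); ring.
Qed.

Lemma den34_horner y w : (den34 y).[w] = (1 - w) ^+ 3 * (quad y).[w] ^+ 2.
Proof.
by rewrite /den34 !(horner_exp, hornerC, hornerX, hornerD, hornerN, hornerM).
Qed.

Lemma den34_deriv_horner y w : (den34 y)^`().[w] =
  - 3 * (1 - w) ^+ 2 * (quad y).[w] ^+ 2 +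
  (1 - w) ^+ 3 * (2 * (quad y).[w] * (2 * w + 2 * (1 - 2 * y ^+ 2))).
Proof.
rewrite /den34 exprS !expr2 !derivM quad_deriv derivB derivX derivC.
by rewrite !(hornerC, hornerX, hornerZ, hornerD, hornerN, hornerM); ring.
Qed.

Lemma num34_horner n y w : (num34 n y).[w] =
  - 16 * y ^+ 2 * (1 - y ^+ 2) / (n%:R * n.+1%:R * n.+2%:R) *
    (w ^+ 3 * (n.+2%:R ^+ 2 * (1 - w ^+ n) + n%:R ^+ 2 * (1 - w ^+ n.+2)
       - 2 * n%:R * n.+2%:R * (w - w ^+ n.+1)))
  + (1 - w ^+ 2) * (1 + w ^+ 4 - gamma1 y * (w + w ^+ 3)
                    + gamma2 n.+1.*2 y * w ^+ 2).
Proof.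
by rewrite /num34 !(hornerC, hornerXn, hornerX, hornerZ, hornerD, hornerN, hornerM).
Qed.

(** Stated for a successor so that differentiation produces the exponent [n] without a predecessor,
    and as a polynomial identity because a second derivative is taken later. *)
Lemma num34_deriv n y : (num34 n.+1 y)^`() =
  (- 16 * y ^+ 2 * (1 - y ^+ 2) / (n.+1%:R * n.+2%:R * n.+3%:R)) *:
    (3 *: 'X^2 * (n.+3%:R ^+ 2 *: (1 - 'X^(n.+1)) + n.+1%:R ^+ 2 *: (1 - 'X^(n.+3))
             - (2 * n.+1%:R * n.+3%:R) *: ('X - 'X^(n.+2)))
     + (n.+1%:R * n.+3%:R) *: ('X^3 * (- n.+3%:R *: 'X^n - n.+1%:R *: 'X^(n.+2)
             - 2%:P + (2 * n.+2%:R) *: 'X^(n.+1))))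
  - 2 *: 'X * (1 + 'X^4 - gamma1 y *: ('X + 'X^3) + gamma2 n.+2.*2 y *: 'X^2)
  + (1 - 'X^2) * (4 *: 'X^3 - gamma1 y *: (1 + 3 *: 'X^2)
                  + (2 * gamma2 n.+2.*2 y) *: 'X).
Proof.
rewrite /num34; move: (gamma1 y) (gamma2 _ y) (- 16 * _ * _ / _) => g1 g2 k.
rewrite !(derivD, derivB, derivN, derivZ, derivM, derivXn, derivX, derivC).
rewrite /= -!scaler_nat -!mul_polyC !(rmorphM, rmorphN, rmorphD, rmorphXn) /=.
ring.
Qed.

Lemma num34_deriv_horner n y w : (num34 n.+1 y)^`().[w] =
  (- 16 * y ^+ 2 * (1 - y ^+ 2) / (n.+1%:R * n.+2%:R * n.+3%:R)) *
    (3 * w ^+ 2 * (n.+3%:R ^+ 2 * (1 - w ^+ n.+1) + n.+1%:R ^+ 2 * (1 - w ^+ n.+3)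
             - (2 * n.+1%:R * n.+3%:R) * (w - w ^+ n.+2))
     + (n.+1%:R * n.+3%:R) * (w ^+ 3 * (- n.+3%:R * w ^+ n - n.+1%:R * w ^+ n.+2
             - 2 + (2 * n.+2%:R) * w ^+ n.+1)))
  - 2 * w * (1 + w ^+ 4 - gamma1 y * (w + w ^+ 3) + gamma2 n.+2.*2 y * w ^+ 2)
  + (1 - w ^+ 2) * (4 * w ^+ 3 - gamma1 y * (1 + 3 * w ^+ 2)
                  + (2 * gamma2 n.+2.*2 y) * w).
Proof.
rewrite num34_deriv.
by rewrite !(hornerC, hornerXn, hornerX, hornerZ, hornerD, hornerN, hornerM).
Qed.

Lemma num34_deriv2_horner1 n y : (num34 n.+1 y)^`()^`().[1] =
  (- 16 * y ^+ 2 * (1 - y ^+ 2) / (n.+1%:R * n.+2%:R * n.+3%:R)) *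
    (6 * (n.+1%:R * n.+3%:R) * (- n.+3%:R - n.+1%:R - 2 + 2 * n.+2%:R)
     + (n.+1%:R * n.+3%:R) * (- n.+3%:R * n%:R - n.+1%:R * n.+2%:R
             + 2 * n.+2%:R * n.+1%:R))
  - 2 * (2 - gamma1 y * 2 + gamma2 n.+2.*2 y)
  - 4 * (4 - gamma1 y * 4 + 2 * gamma2 n.+2.*2 y).
Proof.
rewrite num34_deriv; move: (gamma1 y) (gamma2 _ y) (- 16 * _ * _ / _) => g1 g2 k.
rewrite !(derivD, derivB, derivN, derivZ, derivM, derivXn, derivX, derivC).
rewrite !(hornerC, hornerXn, hornerX, hornerZ, hornerMn, hornerD, hornerN, hornerM).
rewrite /= !expr1n -!natr1; ring.
Qed.

End Fractions.

(** * The fractions under a field embedding *)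

Section MapFractions.
Set Implicit Arguments.
Unset Strict Implicit.
Variables (F K : fieldType) (f : {rmorphism F -> K}).
Implicit Types (y : F) (n : nat).

Definition rmorphE := (rmorph1, rmorph_nat, rmorphD, rmorphN, rmorphXn, rmorphM,
  map_polyZ, map_polyX, fmorphV).

(** The quotient is to have real coefficients, while the multiple zeros that prove divisibility lie
    in the complex field. These lemmas carry divisibility back to the reals. *)
Lemma map_quad y : map_poly f (quad y) = quad (f y).
Proof. by rewrite /quad; do 4 (try rewrite !rmorphE /=). Qed.

Lemma map_num12 n y : map_poly f (num12 n y) = num12 n (f y).
Proof. by rewrite /num12; do 4 (try rewrite !(rmorphE, map_quad) /=). Qed.

Lemma map_den12 y : map_poly f (den12 y) = den12 (f y).
Proof. by rewrite /den12; do 4 (try rewrite !(rmorphE, map_quad) /=). Qed.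

Lemma map_num34 n y : map_poly f (num34 n y) = num34 n (f y).
Proof.
have gen (k a b c g1 g2 : F) : map_poly f (k *: ('X^3 * (a *: (1 - 'X^n) +
      b *: (1 - 'X^(n.+2)) - c *: ('X - 'X^(n.+1)))) +
      (1 - 'X^2) * (1 + 'X^4 - g1 *: ('X + 'X^3) + g2 *: 'X^2)) =
    f k *: ('X^3 * (f a *: (1 - 'X^n) +
      f b *: (1 - 'X^(n.+2)) - f c *: ('X - 'X^(n.+1)))) +
      (1 - 'X^2) * (1 + 'X^4 - f g1 *: ('X + 'X^3) + f g2 *: 'X^2).
  by do 6 (try rewrite !rmorphE /=).
by rewrite gen /num34 /gamma1 /gamma2 !rmorphE.
Qed.

Lemma map_den34 y : map_poly f (den34 y) = den34 (f y).
Proof. by rewrite /den34; do 4 (try rewrite !(rmorphE, map_quad) /=). Qed.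

End MapFractions.

(** * Multiple zeros of the numerators on the unit circle *)

Section Divisibility.
Set Implicit Arguments.
Unset Strict Implicit.
Variable R : realType.
Local Notation C := R[i].
Local Notation U := (chebyshevU R).
Local Notation toC := (map_poly (real_complex R)).
Implicit Types (y t : R) (n : nat).

Lemma expiN t : expi (- t) = (expi t)^-1.
Proof.
have h : expi (- t) * expi t = 1 by rewrite -expiD addNr expi0.
by rewrite -[LHS]mulr1 -(divff (x := expi t)) ?mulrA ?h ?mul1r //;
   apply: contra_eq_neq h => ->; rewrite mulr0 eq_sym oner_eq0.
Qed.

Lemma expi_neq0 t : expi t != 0.
Proof.
have h : expi (- t) * expi t = 1 by rewrite -expiD addNr expi0.
by apply: contra_eq_neq h => ->; rewrite mulr0 eq_sym oner_eq0.
Qed.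

Lemma norm_expi t : `|expi t| = 1.
Proof. by rewrite normc_def /= cos2Dsin2 sqrtr1. Qed.

Lemma cosC t : (cos t)%:C = (expi t + (expi t)^-1) / 2.
Proof.
rewrite -expiN; apply: (mulIf (x := 2)); first by rewrite pnatr_eq0.
rewrite divfK ?pnatr_eq0 // -[2](rmorph_nat (real_complex R)) /expi cosN sinN.
by apply/eqP; rewrite eq_complex /=; apply/andP; split; apply/eqP; ring.
Qed.

Lemma sinC t : (sin t)%:C = (expi t - (expi t)^-1) / (2 * 'i%C).
Proof.
have i0 : 2 * 'i%C != 0 :> C.
  by rewrite mulf_neq0 ?pnatr_eq0 // eq_complex /= oner_eq0 andbF.
rewrite -expiN; apply: (mulIf i0).
rewrite divfK // -[2](rmorph_nat (real_complex R)) /expi cosN sinN.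
by apply/eqP; rewrite eq_complex /=; apply/andP; split; apply/eqP; ring.
Qed.

(** For y = cos t, y^2 is a rational function of w = exp(2it), which turns the conditions at the
    zeros of [quad] into identities for [field]. *)
Lemma sqr_cosC t :
  (cos t)%:C ^+ 2 = (1 + expi (2 * t)) ^+ 2 / (4 * expi (2 * t)).
Proof.
have -> : expi (2 * t) = expi t ^+ 2 by rewrite expiX.
rewrite cosC; field.
by rewrite expi_neq0.
Qed.

Lemma quad_factor t : quad (cos t)%:C =
  ('X - (expi (2 * t))%:P) * ('X - (expi (- (2 * t)))%:P) :> {poly C}.
Proof.
rewrite /quad sqr_cosC expiN; have := expi_neq0 (2 * t).
move: (expi _) => w w0.
have h : 2 * (1 - 2 * ((1 + w) ^+ 2 / (4 * w))) = - (w + w^-1) by field.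
rewrite h scaleNr -mul_polyC rmorphD /=.
have : w%:P * w^-1%:P = 1 :> {poly C} by rewrite -polyCM divff.
by move: (w%:P) (w^-1%:P) => a b ab; ring: ab.
Qed.

(** Positive sine and cosine give sin 2t <> 0, so 1, exp(2it) and exp(-2it) are distinct and the
    three prime powers are pairwise coprime. *)
Lemma dvdp_den t k (p : {poly C}) : 0 < sin t -> 0 < cos t ->
    ('X - 1%:P) ^+ k %| p ->
    (forall s, (s = t) \/ (s = - t) ->
       p.[expi (2 * s)] = 0 /\ p^`().[expi (2 * s)] = 0) ->
  (1 - 'X) ^+ k * quad (cos t)%:C ^+ 2 %| p.
Proof.
move=> st ct dk ps.
have [p1 p1'] := ps t (or_introl erefl).
have [] := ps (- t) (or_intror erefl); rewrite mulrN => p2 p2'.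
rewrite quad_factor exprMn -[1]/(1%:P) -opprB exprNn -mulrA.
have nz1 s : sin s != 0 -> cos s != 0 -> (1 : C) != expi (2 * s).
  move=> s0 c0; rewrite eq_complex /= negb_and; apply/orP; right.
  have -> : 2 * s = s + s by ring.
  rewrite sinD eq_sym [cos s * _]mulrC -mulr2n mulrn_eq0 /= mulf_eq0.
  by rewrite (negbTE s0) (negbTE c0).
have nzz : expi (2 * t) != expi (- (2 * t)).
  rewrite eq_complex /= negb_and; apply/orP; right.
  have -> : 2 * t = t + t by ring.
  rewrite sinN -addr_eq0 -mulr2n mulrn_eq0 /= sinD [cos t * _]mulrC -mulr2n.
  by rewrite mulrn_eq0 /= mulf_eq0 !gt_eqF.
have n1 := nz1 t (lt0r_neq0 st) (lt0r_neq0 ct).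
have n2 : 1 != expi (- (2 * t)).
  by rewrite -mulrN; apply: nz1; rewrite ?sinN ?cosN ?oppr_eq0 gt_eqF.
rewrite -signr_odd mulr_sign.
suff h : ('X - 1%:P) ^+ k * (('X - (expi (2 * t))%:P) ^+ 2 *
   ('X - (expi (- (2 * t)))%:P) ^+ 2) %| p by case: (odd k); rewrite ?dvdpNl.
rewrite Gauss_dvdp; last by rewrite coprimepMr !coprimep_XsubC_exp.
rewrite dk Gauss_dvdp; last by rewrite coprimep_XsubC_exp.
by rewrite !dvdp_XsubC_sqr.
Qed.

Lemma num12_root n t : cos t != 0 -> sin (n.+1%:R * t) = 0 ->
  (num12 n (cos t)%:C).[expi (2 * t)] = 0 /\
  (num12 n (cos t)%:C)^`().[expi (2 * t)] = 0.
Proof.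
move=> c0 s0; set w := expi (2 * t).
have w0 : w != 0 by exact: expi_neq0.
have wn : w ^+ n.+1 = 1.
  rewrite expiX mulrCA -expiX /expi s0.
  have : cos (n.+1%:R * t) ^+ 2 = 1.
    by have := cos2Dsin2 (n.+1%:R * t); rewrite s0; lra.
  by rewrite complexr0 -rmorphXn /= => ->.
have qw : (quad (cos t)%:C).[w] = 0.
  by rewrite quad_factor hornerM hornerXsubC subrr mul0r.
rewrite num12_horner num12_deriv_horner qw wn; split; first by ring.
have -> : w ^+ n = w^-1.
  by apply: (mulfI w0); rewrite -exprS wn divff.
rewrite sqr_cosC -/w; field.
by rewrite w0 nat1r pnatr_eq0.
Qed.

Lemma cos_itv y : 0 < y < 1 -> exists t, [/\ y = cos t, 0 < sin t & 0 < cos t].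
Proof.
move=> /andP[y0 y1]; have yN1 : -1 < y by lra.
have yE : cos (acos y) = y by apply: acosK; rewrite in_itv /= !ltW.
exists (acos y); rewrite yE; split=> //.
apply: sin_gt0_pi; apply/andP; split.
  by apply: acos_gt0; rewrite y1 ltW.
by apply: acos_ltpi; rewrite yN1 ltW.
Qed.

Lemma num12_dvdp n y : 0 < y < 1 -> root (U n) y -> den12 y %| num12 n y.
Proof.
move=> /cos_itv[t [-> st ct]] yr.
have s0 : sin (n.+1%:R * t) = 0 by rewrite -chebyshevU_cos (eqP yr) mul0r.
rewrite -(dvdp_map (real_complex R)) map_num12 map_den12 /= /den12.
rewrite -[1 - 'X]expr1; apply: dvdp_den => //.
  by rewrite dvdp_XsubCl /root num12_horner !expr1n; apply/eqP; ring.
have c0 : cos t != 0 by rewrite gt_eqF.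
move=> s [->|->]; first exact: num12_root.
rewrite -[cos t]cosN; apply: num12_root; first by rewrite cosN.
by rewrite mulrN sinN s0 oppr0.
Qed.

(** Unlike for [num12], w = exp(2it) need not be a root of unity. The equation U_n' = 0 is instead
    linear in the power of w, which can be eliminated as a rational function of w and n. *)
Lemma num34_root n t : cos t != 0 -> sin t != 0 ->
    n.+3%:R * sin (n.+1%:R * t) = n.+1%:R * sin (n.+3%:R * t) ->
  (num34 n.+1 (cos t)%:C).[expi (2 * t)] = 0 /\
  (num34 n.+1 (cos t)%:C)^`().[expi (2 * t)] = 0.
Proof.
move=> c0 st s0; set w := expi (2 * t).
have w0 : w != 0 by exact: expi_neq0.
(* The moduli n + 3 and n + 1 of the two terms differ because |w| = 1. *)
have D0 : n%:R + 3 - (n%:R + 1) * w != 0.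
  rewrite subr_eq0; apply/eqP => /(congr1 (fun u : C => `|u|)).
  rewrite normrM norm_expi mulr1 natr1 -natrD !normr_nat => /eqP.
  by rewrite eqr_nat addn3 eqSS => /eqP; lia.
have wn : w ^+ n =
    ((n%:R + 3) * w - (n%:R + 1)) / (w ^+ 2 * (n%:R + 3 - (n%:R + 1) * w)).
  have := congr1 (real_complex R) s0.
  rewrite /w !rmorphM !rmorph_nat /= !sinC -!expiX.
  move: D0; rewrite /w; have -> : expi (2 * t) = expi t ^+ 2 by rewrite expiX.
  have := expi_neq0 t; move: (expi t) => e e0 D0.
  rewrite -[(e ^+ 2) ^+ n]exprM mulnC exprM -[in n.+3]addn3 -[in n.+1]addn1.
  rewrite !exprD expr1.
  have := expf_neq0 n e0; move: (e ^+ n) => en en0.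
  have i0 : 'i%C != 0 :> C by rewrite eq_complex /= oner_eq0 andbF.
  rewrite !natrD; move: (n%:R) D0 => m D0 H.
  have e4 : e ^+ 2 ^+ 2 * (m + 3 - (m + 1) * e ^+ 2) != 0.
    by rewrite mulf_neq0 ?expf_neq0.
  apply: (mulIf e4); rewrite divfK //; apply/eqP; rewrite -subr_eq0; apply/eqP.
  transitivity ((((m + 3) * ((en * e - (en * e)^-1) / (2 * 'i%C))) -
    (m + 1) * ((en * e ^+ 3 - (en * e ^+ 3)^-1) / (2 * 'i%C)))
    * (en * e ^+ 3 * 2 * 'i%C)); last by rewrite H subrr mul0r.
  by field; rewrite en0 e0 i0.
rewrite num34_horner num34_deriv_horner /gamma1 /gamma2.
rewrite [w ^+ n.+3]exprS [w ^+ n.+2]exprS [w ^+ n.+1]exprS wn.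
rewrite [(cos t)%:C ^+ 4](exprM _ 2 2) sqr_cosC -/w -mul2n natrM -!natr1.
have n1 : n%:R + 1 != 0 :> C by rewrite natr1 pnatr_eq0.
have n2 : n%:R + 1 + 1 != 0 :> C by rewrite !natr1 pnatr_eq0.
have n3 : n%:R + 1 + 1 + 1 != 0 :> C by rewrite !natr1 pnatr_eq0.
move: (n%:R) n1 n2 n3 D0 => m n1 n2 n3 D0.
split; field.
  by rewrite w0 D0 n1 n2 n3.
by rewrite w0 D0 n1 n2 n3.
Qed.

Lemma num34_dvdp n y : 0 < y < 1 -> root (U n.+1)^`() y ->
  den34 y %| num34 n.+1 y.
Proof.
move=> /cos_itv[t [-> st ct]] yr.
have s0 : n.+3%:R * sin (n.+1%:R * t) = n.+1%:R * sin (n.+3%:R * t).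
  apply/eqP; rewrite -subr_eq0 -deriv_chebyshevU_cos.
  by rewrite (eqP yr) mulr0.
rewrite -(dvdp_map (real_complex R)) map_num34 map_den34 /= /den34.
have n1 : n%:R + 1 != 0 :> C by rewrite natr1 pnatr_eq0.
have n2 : n%:R + 1 + 1 != 0 :> C by rewrite !natr1 pnatr_eq0.
have n3 : n%:R + 1 + 1 + 1 != 0 :> C by rewrite !natr1 pnatr_eq0.
apply: dvdp_den => //.
  (* The triple zero at w = 1 is present for every y: the terms of [gamma2] in 1/M balance the
     contribution of [G3]. *)
  apply: dvdp_XsubC_cube; first by rewrite pnatr_eq0.
  - by rewrite num34_horner !expr1n; ring.
  - rewrite num34_deriv_horner !expr1n /gamma1 /gamma2 -mul2n natrM -!natr1.
    field.
    by rewrite n1 n2 n3.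
  - rewrite num34_deriv2_horner1 /gamma1 /gamma2 -mul2n natrM -!natr1.
    field.
    by rewrite n1 n2 n3.
have c0 : cos t != 0 by rewrite gt_eqF.
have sn0 : sin t != 0 by rewrite gt_eqF.
move=> s [->|->]; first exact: num34_root.
rewrite -[cos t]cosN; apply: num34_root; rewrite ?cosN ?sinN ?oppr_eq0 //.
by rewrite !mulrN !sinN !mulrN s0.
Qed.

End Divisibility.

(** * Degrees and lowest coefficients of the quotients *)

Section Quotients.
Set Implicit Arguments.
Unset Strict Implicit.
Variable R : realType.
Local Notation U := (chebyshevU R).
Implicit Types (p q h : {poly R}) (y c : R) (n m i : nat).

Lemma size_addZXn c m q : c != 0 -> (size q <= m)%N ->
  size (c *: 'X^m + q) = m.+1.
Proof.
by move=> c0 qm; rewrite size_polyDl size_scale // size_polyXn // ltnS.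
Qed.

Lemma size_add_leq p q m :
  (size p <= m)%N -> (size q <= m)%N -> (size (p + q)%R <= m)%N.
Proof.
by move=> *; rewrite (leq_trans (size_polyD _ _)) // geq_max; apply/andP.
Qed.

Lemma size_ZXn_leq c i m : (i < m)%N -> (size (c *: 'X^i : {poly R}) <= m)%N.
Proof.
by move=> im; rewrite (leq_trans (size_scale_leq _ _)) // size_polyXn.
Qed.

Lemma size_quad y : size (quad y) = 3%N.
Proof.
have -> : quad y = 1 *: 'X^2 + ((2 * (1 - 2 * y ^+ 2)) *: 'X^1 + 1 *: 'X^0).
  by rewrite /quad expr1 expr0 !scale1r; ring.
apply: size_addZXn; first exact: oner_neq0.
by apply: size_add_leq; apply: size_ZXn_leq.
Qed.

Lemma size_1subX_exp k : size ((1 - 'X) ^+ k : {poly R}) = k.+1.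
Proof.
have h : size ((1 - 'X) : {poly R}) = 2%N.
  by rewrite -opprB size_polyN; exact: size_XsubC.
have h0 : (1 - 'X : {poly R}) != 0 by rewrite -size_poly_eq0 h.
elim: k => [|k IH]; first by rewrite expr0 size_poly1.
by rewrite exprS size_mul ?expf_neq0 // h IH.
Qed.

Lemma size_den k y : size ((1 - 'X) ^+ k * quad y ^+ 2) = (k + 5)%N.
Proof.
have q0 : quad y != 0 by rewrite -size_poly_eq0 size_quad.
have sq : size (quad y ^+ 2) = 5%N.
  by rewrite expr2 size_mul // size_quad.
rewrite size_mul ?size_1subX_exp ?sq ?addSn //=.
  by rewrite -size_poly_eq0 size_1subX_exp.
by rewrite -size_poly_eq0 sq.
Qed.

Lemma size_num12 n y : (1 < n)%N -> 0 < y < 1 -> size (num12 n y) = n.+4.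
Proof.
move=> n1 /andP[y0 y1]; rewrite /num12; set k := _ / _.
have k0 : - k != 0.
  rewrite oppr_eq0 gt_eqF // /k divr_gt0 ?ltr0n // !mulr_gt0 ?exprn_gt0 //.
  by rewrite subr_gt0 expr_lt1 // ltW.
set c := 2 * (1 - 2 * y ^+ 2).
(* For n > 1 the monomial X^(n+3) dominates the X^4 of the second summand, and its coefficient is
   nonzero because 0 < y < 1. *)
have -> : k *: ('X^2 * (1 - 'X^(n.+1))) + (1 - 'X^2) * quad y =
  - k *: 'X^(n.+3) + (k *: 'X^2 + (1 *: 'X^0 + (c *: 'X^1 + ((- c) *: 'X^3 +
     (-1) *: 'X^4)))).
  rewrite /quad -/c -!mul_polyC !polyCN !rmorph1 !exprS !expr0; ring.
apply: size_addZXn => //.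
by do ![apply: size_add_leq]; apply: size_ZXn_leq; lia.
Qed.

Lemma size_num34 n y : (0 < n)%N -> 0 < y < 1 ->
  size (num34 n.+1 y) = (n + 7)%N.
Proof.
move=> n1 /andP[y0 y1]; rewrite /num34; set k := _ / _.
move: (gamma1 y) (gamma2 _ y) => g1 g2.
have k0 : - (k * n.+1%:R ^+ 2) != 0.
  rewrite oppr_eq0 mulf_neq0 // ?expf_neq0 ?pnatr_eq0 //.
  rewrite /k !mulf_neq0 ?invr_eq0 ?mulf_neq0 ?pnatr_eq0 ?oppr_eq0 ?pnatr_eq0
    ?expf_neq0 ?gt_eqF //.
  by rewrite subr_gt0 expr_lt1 // ltW.
move: (n.+3%:R ^+ 2) (n.+1%:R ^+ 2) k0 (2 * _ * _) => a b k0 c.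
have -> : k *: ('X^3 * (a *: (1 - 'X^(n.+1)) + b *: (1 - 'X^(n.+3))
     - c *: ('X - 'X^(n.+2)))) + (1 - 'X^2) *
     (1 + 'X^4 - g1 *: ('X + 'X^3) + g2 *: 'X^2) =
  - (k * b) *: 'X^(n.+1 + 5) + ((k * a + k * b) *: 'X^3 + ((- (k * a)) *: 'X^(n + 4) +
    ((- (k * c)) *: 'X^4 + ((k * c) *: 'X^(n + 5) +
    (1 *: 'X^0 + ((- g1) *: 'X^1 + ((g2 - 1) *: 'X^2 + ((1 - g2) *: 'X^4 +
    (g1 *: 'X^5 + (-1) *: 'X^6))))))))).
  rewrite -!mul_polyC !(polyCN, polyCD, polyCM) !exprD expr0 expr1 !exprS !expr0.
  rewrite rmorph1; ring.
rewrite size_addZXn ?addSn -?addnS //.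
by do ![apply: size_add_leq]; apply: size_ZXn_leq; lia.
Qed.

Lemma coef1_horner p : p`_1 = p^`().[0].
Proof. by rewrite horner_coef0 coef_deriv. Qed.

Lemma quotient_coefs (num den h : {poly R}) : num = h * den ->
  den.[0] = 1 -> h`_0 = num.[0] /\ h`_1 = num^`().[0] - num.[0] * den^`().[0].
Proof.
move=> ->; rewrite derivM hornerD !hornerM => ->.
rewrite -horner_coef0 coef1_horner !mulr1; split=> //.
by ring.
Qed.

(** The polynomial z h(z^2) has degree 2n - 3, which is N or N - 1 in the odd and even cases of the
    theorem. Its coefficient of z^3 is h_1, so the bound on a_3 is attained. *)
Lemma quotient12 n y : (1 < n)%N -> 0 < y < 1 -> root (U n) y ->
  exists h, [/\ num12 n y = h * den12 y, size h = n.-1, h`_0 = 1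
              & h`_1 = 4 * y ^+ 2 - 1].
Proof.
move=> n1 yI yr; have /divpK numE := num12_dvdp yI yr.
set h := _ %/ _ in numE.
have sd : size (den12 y) = 6%N by rewrite /den12 -[1 - _]expr1 size_den.
have d0 : den12 y != 0 by rewrite -size_poly_eq0 sd.
have sn := size_num12 n1 yI.
have h0 : h != 0.
  by apply: contra_eq_neq numE => ->; rewrite mul0r eq_sym -size_poly_eq0 sn.
have den0 : (den12 y).[0] = 1 by rewrite den12_horner horner_quad; ring.
have szE : (size h + size (den12 y)).-1 = n.+4 by rewrite -size_mul // numE.
exists h; split=> //.
- by apply: (@addIn 5); rewrite sd addnS /= in szE; apply: (etrans szE); lia.
- have [-> _] := quotient_coefs (esym numE) den0.
  by rewrite num12_horner horner_quad; ring.
- have [_ ->] := quotient_coefs (esym numE) den0.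
  rewrite num12_horner den12_deriv_horner num12_deriv_horner horner_quad.
  ring.
Qed.

Lemma quotient34 n y : (0 < n)%N -> 0 < y < 1 -> root (U n.+1)^`() y ->
  exists h, [/\ num34 n.+1 y = h * den34 y, size h = n, h`_0 = 1
              & h`_1 = 4 * y ^+ 2 - 1].
Proof.
move=> n1 yI yr; have /divpK numE := num34_dvdp yI yr.
set h := _ %/ _ in numE.
have sd : size (den34 y) = 8%N by rewrite /den34 size_den.
have d0 : den34 y != 0 by rewrite -size_poly_eq0 sd.
have sn := size_num34 n1 yI.
have h0 : h != 0.
  apply: contra_eq_neq numE => ->.
  by rewrite mul0r eq_sym -size_poly_eq0 sn addnS.
have den0 : (den34 y).[0] = 1 by rewrite den34_horner horner_quad; ring.
have szE : (size h + size (den34 y)).-1 = (n + 7)%N by rewrite -size_mul // numE.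
exists h; split=> //.
- by apply: (@addIn 7); rewrite sd addnS /= in szE; apply: (etrans szE).
- have [-> _] := quotient_coefs (esym numE) den0.
  by rewrite num34_horner /gamma1; ring.
- have [_ ->] := quotient_coefs (esym numE) den0.
  rewrite num34_horner den34_deriv_horner num34_deriv_horner horner_quad /gamma1.
  ring.
Qed.

End Quotients.

(** * The rational functions on the unit circle *)

Section CircleValues.
Set Implicit Arguments.
Unset Strict Implicit.
Variable R : realType.
Local Notation C := R[i].
Local Notation Im := (@complex.Im R).
Local Notation toC := (map_poly (real_complex R)).
Implicit Types (t y : R) (n : nat).

Lemma i_neq0 : 'i%C != 0 :> C.
Proof. by rewrite eq_complex /= oner_eq0 andbF. Qed.

Lemma quartic_expi y t :
  quartic (expi t) y%:C = 4 * expi t ^+ 2 * ((cos t)%:C ^+ 2 - y%:C ^+ 2).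
Proof. by rewrite cosC /quartic; field; rewrite expi_neq0. Qed.

Lemma sub1_expi_sqr t : 1 - expi t ^+ 2 = - 2 * 'i%C * expi t * (sin t)%:C.
Proof. by rewrite sinC; field; rewrite expi_neq0 i_neq0. Qed.

Lemma Theta_reg_expi y t : Theta_reg y t ->
  [/\ (sin t)%:C != 0 :> C, (cos t)%:C ^+ 2 - y%:C ^+ 2 != 0
    & G_reg y%:C (expi t)].
Proof.
move=> /andP[s0 c0].
have sC : (sin t)%:C != 0 :> C by rewrite eq_complex /= eqxx andbT.
have cC : (cos t)%:C ^+ 2 - y%:C ^+ 2 != 0.
  by rewrite -!rmorphXn -rmorphB eq_complex /= eqxx andbT.
split=> //; apply/andP; split.
  by rewrite sub1_expi_sqr !mulf_neq0 ?oppr_eq0 ?pnatr_eq0 ?i_neq0 ?expi_neq0.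
by rewrite quartic_expi !mulf_neq0 ?expf_neq0 ?pnatr_eq0 ?expi_neq0.
Qed.

Lemma G2_expi y t : Theta_reg y t ->
  G2 (expi t) y%:C = (cos t / (2 * (cos t ^+ 2 - y ^+ 2)))%:C.
Proof.
move=> /Theta_reg_expi[_ c0 _]; rewrite /G2 quartic_expi !rmorphE /=.
move: c0; set D := _ ^+ 2 - _ ^+ 2 => D0; rewrite cosC; move: D D0 => D D0.
by field; rewrite D0 expi_neq0.
Qed.

(** All phases cancel except exp(i(n + 1)t), whose imaginary part completes the square sin^2((n +
    1)t) of [Theta]; [G2] is real on the circle. *)
Lemma G1_expi n y t : Theta_reg y t -> G1 n.+1.*2 (expi t) y%:C =
  (2 * y ^+ 2 * (1 - y ^+ 2) * sin (n.+1%:R * t) /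
     (2 * n.+1%:R * sin t * (cos t ^+ 2 - y ^+ 2) ^+ 2))%:C * expi (n.+1%:R * t).
Proof.
move=> /Theta_reg_expi[s0 c0 _].
rewrite /G1 quartic_expi sub1_expi_sqr !rmorphE /= -mul2n mulnC exprM.
rewrite [expi t ^+ n.+1]expiX sub1_expi_sqr natrM.
have n1 : n.+1%:R != 0 :> C by rewrite pnatr_eq0.
move: c0 n1 (sin (_ * t))%:C (expi (_ * t)); move: (_ ^+ 2 - _ ^+ 2) (n.+1%:R).
move=> D m D0 m0 u E; move: (sin t)%:C s0 => s s0.
by field; rewrite D0 m0 s0 i_neq0 expi_neq0.
Qed.

Lemma G12_fraction n (y z : C) : G_reg y z ->
  G1 n.+1.*2 z y + G2 z y = z * ((num12 n y).[z ^+ 2] / (den12 y).[z ^+ 2]).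
Proof.
move=> /andP[z1 q0].
rewrite num12_horner den12_horner quad_quartic /G1 /G2 -mul2n exprM.
have n1 : n.+1%:R != 0 :> C by rewrite pnatr_eq0.
rewrite natrM; move: (quartic z y) q0 (n.+1%:R) n1 => q q0 m m0.
move: (z ^+ 2 ^+ n.+1) => u.
by field; rewrite z1 q0 m0.
Qed.

Lemma G34_fraction n (y z : C) : (0 < n)%N -> G_reg y z ->
  G3 n.+1.*2 z y + G4 n.+1.*2 z y =
  z * ((num34 n y).[z ^+ 2] / (den34 y).[z ^+ 2]).
Proof.
move=> n0 /andP[z1 q0].
rewrite num34_horner den34_horner quad_quartic /G3 /G4 /gamma1 /gamma2.
have -> : (n.+1.*2 - 2 = 2 * n)%N by lia.
have -> : (n.+1.*2 + 2 = 2 * n.+2)%N by lia.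
rewrite -mul2n !(exprM z 2) natrM -natr1 -!(natr1 n.+1) -(natr1 n).
have n1 : n%:R + 1 != 0 :> C by rewrite natr1 pnatr_eq0.
have n2 : n%:R + 1 + 1 != 0 :> C by rewrite !natr1 pnatr_eq0.
have n3 : n%:R != 0 :> C by rewrite pnatr_eq0 -lt0n.
rewrite [z ^+ 2 ^+ n.+2]exprS [z ^+ 2 ^+ n.+1]exprS.
move: (quartic z y) q0 (n%:R) n1 n2 n3 => q q0 m m1 m2 m3.
move: (z ^+ 2 ^+ n) => u.
have m4 : 2 * (m + 1) + 2 != 0.
  have -> : 2 * (m + 1) + 2 = 2 * (m + 1 + 1) by ring.
  by rewrite mulf_neq0 // pnatr_eq0.
have m5 : 2 * (m + 1) - 2 != 0.
  have -> : 2 * (m + 1) - 2 = 2 * m by ring.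
  by rewrite mulf_neq0 // pnatr_eq0.
by field; rewrite z1 q0 m1 m2 m3 m4 m5.
Qed.

Lemma Im_G12 n y t : Theta_reg y t ->
  Im (G1 n.+1.*2 (expi t) y%:C + G2 (expi t) y%:C) = Theta n.+1.*2 t y.
Proof.
move=> treg; rewrite ImD G2_expi // G1_expi // ImZ addr0 /Theta /=.
have -> : n.+1.*2%:R / 2 * t = n.+1%:R * t by rewrite -mul2n natrM; field.
move/andP: treg => [s0 c0]; have n1 : n.+1%:R != 0 :> R by rewrite pnatr_eq0.
rewrite -mul2n natrM; move: (n.+1%:R) n1 (sin (_ * t)) => m m0 u.
move: (cos t ^+ 2 - _) c0 => D D0.
by field; rewrite D0 m0 s0.
Qed.

(** Numerator and denominator are self-reciprocal of the same degree, so [G4] is real on the circle.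
    The explicit value comes from 2 cos 4t and 2 cos 2t expressed in cos t. *)
Lemma G4_expi_real n y t : Theta_reg y t -> Im (G4 n.+1.*2 (expi t) y%:C) = 0.
Proof.
move=> /Theta_reg_expi[s0 c0 _].
suff -> : G4 n.+1.*2 (expi t) y%:C =
  (- 2 * cos t * (16 * cos t ^+ 4 - 16 * cos t ^+ 2 + 2
     - gamma1 y * (4 * cos t ^+ 2 - 2) + gamma2 n.+1.*2 y) /
     (64 * sin t ^+ 2 * (cos t ^+ 2 - y ^+ 2) ^+ 2))%:C by [].
have g1E : gamma1 y%:C = (gamma1 y)%:C by rewrite /gamma1 !rmorphE.
have g2E : gamma2 n.+1.*2 y%:C = (gamma2 n.+1.*2 y)%:C.
  by rewrite /gamma2 !rmorphE.
rewrite /G4 quartic_expi sub1_expi_sqr g1E g2E.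
move: (gamma1 y) (gamma2 _ y) => g1 g2.
rewrite !rmorphE /=; move: c0; set D := _ ^+ 2 - _ ^+ 2 => D0.
rewrite cosC; move: D D0 (sin t)%:C s0 g1%:C g2%:C => D D0 s s0 a b.
have -> : (- 2 * 'i%C * expi t * s) ^+ 2 = - 4 * expi t ^+ 2 * s ^+ 2.
  by rewrite !exprMn sqr_i; ring.
by field; rewrite D0 s0 expi_neq0.
Qed.

(** The grouping is chosen so that the imaginary part of the bracket is the perfect square ((n + 2)
    sin(nt) - n sin((n + 2)t))^2. *)
Lemma G3_expi n y t : (0 < n)%N -> Theta_reg y t ->
  G3 n.+1.*2 (expi t) y%:C =
  (y ^+ 2 * (1 - y ^+ 2) /
     (4 * n%:R * n.+1%:R * n.+2%:R * sin t ^+ 3 * (cos t ^+ 2 - y ^+ 2) ^+ 2))%:C *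
  ((n.+2%:R ^+ 2 * sin (n%:R * t))%:C * expi (n%:R * t) +
   (n%:R ^+ 2 * sin (n.+2%:R * t) - 2 * n%:R * n.+2%:R * sin (n%:R * t))%:C *
      expi (n.+2%:R * t)).
Proof.
move=> n0 /Theta_reg_expi[s0 c0 _].
rewrite /G3 quartic_expi sub1_expi_sqr.
have -> : (n.+1.*2 - 2 = n * 2)%N by lia.
have -> : (n.+1.*2 + 2 = n.+2 * 2)%N by lia.
have -> : expi t ^+ 2 - expi t ^+ n.+1.*2 =
    expi (2 * t) * (1 - expi (n%:R * t) ^+ 2).
  rewrite -!expiX mulrBr mulr1 -exprM -exprD; congr (_ - _ ^+ _); lia.
rewrite !(exprM (expi t)) [expi t ^+ n]expiX [expi t ^+ n.+2]expiX !sub1_expi_sqr.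
have -> : expi (n.+2%:R * t) = expi (2 * t) * expi (n%:R * t).
  by rewrite -expiD -!natr1; congr expi; ring.
have -> : (- 2 * 'i%C * expi t * (sin t)%:C) ^+ 3 =
    8 * 'i%C * expi t ^+ 3 * (sin t)%:C ^+ 3 :> C.
  by rewrite !exprMn [X in _ * X * _ * _]exprS sqr_i; ring.
have -> : expi (2 * t) = expi t ^+ 2 by rewrite expiX.
rewrite -mul2n natrM !rmorphE /= -natr1 -!(natr1 n.+1) -(natr1 n).
have n1 : n%:R + 1 != 0 :> C by rewrite natr1 pnatr_eq0.
have n2 : n%:R + 1 + 1 != 0 :> C by rewrite !natr1 pnatr_eq0.
have n3 : n%:R != 0 :> C by rewrite pnatr_eq0 -lt0n.
move: (n%:R) n1 n2 n3 => m m1 m2 m3.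
have m4 : 2 * (m + 1) + 2 != 0.
  have -> : 2 * (m + 1) + 2 = 2 * (m + 1 + 1) by ring.
  by rewrite mulf_neq0 // pnatr_eq0.
have m5 : 2 * (m + 1) - 2 != 0.
  have -> : 2 * (m + 1) - 2 = 2 * m by ring.
  by rewrite mulf_neq0 // pnatr_eq0.
move: c0; set D := _ ^+ 2 - _ ^+ 2 => D0; move: D D0 => D D0.
have := expi_neq0 t; move: (expi t) => e e0.
move: (expi (_ * _)) (sin t)%:C s0 => E s s0.
move: (sin _)%:C (sin _)%:C => u v.
have i0 := i_neq0; move: 'i%C i0 => i i0.
by field; rewrite D0 m1 m2 m3 m4 m5 s0 e0 i0.
Qed.

Lemma Im_G34 n y t : (0 < n)%N -> Theta_reg y t ->
  Im (G3 n.+1.*2 (expi t) y%:C + G4 n.+1.*2 (expi t) y%:C) =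
  hatTheta n.+1.*2 t y.
Proof.
move=> n0 treg; rewrite ImD G4_expi_real // G3_expi // ImZ ImD !ImZ addr0.
rewrite /hatTheta /=.
move/andP: treg => [s0 c0].
have -> : (n.+1.*2%:R - 2) / 2 * t = n%:R * t.
  by rewrite -mul2n natrM -natr1; field.
have -> : (n.+1.*2%:R + 2) / 2 * t = n.+2%:R * t.
  by rewrite -mul2n natrM -!natr1; field.
rewrite -mul2n natrM -natr1 -!(natr1 n.+1) -(natr1 n).
have n1 : n%:R + 1 != 0 :> R by rewrite natr1 pnatr_eq0.
have n2 : n%:R + 1 + 1 != 0 :> R by rewrite !natr1 pnatr_eq0.
have n3 : n%:R != 0 :> R by rewrite pnatr_eq0 -lt0n.
move: (n%:R) n1 n2 n3 (sin (_ * t)) (sin (_ * t)) => m m1 m2 m3 u v.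
have m4 : 2 * (m + 1) + 2 != 0.
  have -> : 2 * (m + 1) + 2 = 2 * (m + 1 + 1) by ring.
  by rewrite mulf_neq0 // pnatr_eq0.
have m5 : 2 * (m + 1) - 2 != 0.
  have -> : 2 * (m + 1) - 2 = 2 * m by ring.
  by rewrite mulf_neq0 // pnatr_eq0.
move: (cos t ^+ 2 - _) c0 => D D0.
by field; rewrite D0 m1 m2 m3 m4 m5 s0.
Qed.

End CircleValues.

(** * Values at the removable singularities *)

Section Continuity.
Set Implicit Arguments.
Unset Strict Implicit.

Lemma continuous_horner_num (K : numFieldType) (p : {poly K}) :
  continuous (horner p).
Proof.
elim/poly_ind: p => [|p c IH] x.
  have -> : horner (0 : {poly K}) = cst 0 by apply/funext => u; rewrite horner0.
  exact: cst_continuous.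
have -> : horner (p * 'X + c%:P) = (horner p \* id) \+ cst c.
  by apply/funext => u; rewrite hornerMXaddC.
apply: continuousD; last exact: cst_continuous.
by apply: continuousM; [exact: IH|move=> ?; exact: cvg_id].
Qed.

Lemma near_neq0 (K : numFieldType) (f : K -> K) x :
  {for x, continuous f} -> f x != 0 -> \forall u \near x, f u != 0.
Proof. by move=> cf fx; exact: cvgr_neq0 cf fx. Qed.

(** Splitting off the full power of X - x leaves a factor nonzero at x, hence near x. *)
Lemma near_dnbhs_horner_neq0 (K : numFieldType) (p : {poly K}) x : p != 0 ->
  \forall u \near x^', p.[u] != 0.
Proof.
move=> p0; have [m [q /implyP/(_ p0) qx ->]] := multiplicity_XsubC p x.
have qx0 : \forall u \near x, q.[u] != 0.
  by apply: near_neq0 => //; exact: continuous_horner_num.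
near=> u.
rewrite hornerM horner_exp hornerXsubC mulf_neq0 ?expf_neq0 ?subr_eq0 //.
  by near: u; exact: nbhs_dnbhs.
by near: u; exact: nbhs_dnbhs_neq.
Unshelve. all: by end_near. Qed.

Lemma eq_by_continuityP (K : numFieldType) (reg : pred K) (f g : K -> K) :
    continuous f -> (forall x, reg x -> f x = g x) ->
    (forall x, \forall u \near x^', reg u) ->
  eq_by_continuity reg f g.
Proof.
move=> cf fg nreg x; split=> [|_]; first exact: fg.
apply: cvg_trans ((continuous_withinNx f x).1 (cf x)).
apply: near_eq_cvg; near=> u; apply: fg; near: u; exact: nreg.
Unshelve. all: by end_near. Qed.

Variable R : realType.
Implicit Types (x y t : R).

Lemma near_dnbhs_sin_sub x : \forall u \near x^', sin (u - x) != 0.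
Proof.
near=> u.
have ux : u != x by near: u; exact: nbhs_dnbhs_neq.
have d : `|u - x| < pi.
  rewrite distrC; near: u; apply: nbhs_dnbhs.
  exact: (nbhsx_ballx x _ (pi_gt0 R)).
have [h|h|h] := ltgtP (u - x) 0.
- rewrite -oppr_eq0 -sinN gt_eqF // sin_gt0_pi // oppr_gt0 h /=.
  by move: d; rewrite (ltr0_norm h).
- rewrite gt_eqF // sin_gt0_pi // h /=.
  by move: d; rewrite (gtr0_norm h).
- by move/eqP: h; rewrite subr_eq0 (negbTE ux).
Unshelve. all: by end_near. Qed.

(** At a singular x with cos^2 x = y^2, the difference cos^2 u - y^2 equals -sin(u - x) sin(u + x),
    and sin 2x <> 0 because y is neither 0 nor 1. *)
Lemma near_Theta_reg x y : 0 < y < 1 -> \forall u \near x^', Theta_reg y u.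
Proof.
move=> /andP[y0 y1].
have nsin : \forall u \near x^', sin u != 0.
  have [sx|sx] := eqVneq (sin x) 0; last first.
    by apply/nbhs_dnbhs/near_neq0; [exact: continuous_sin|].
  apply: filterS (near_dnbhs_sin_sub x) => u.
  by rewrite sinB sx mulr0 subr0 mulf_eq0 negb_or => /andP[].
suff ncos : \forall u \near x^', cos u ^+ 2 - y ^+ 2 != 0.
  by near=> u; apply/andP; split; near: u.
have [cx|cx] := eqVneq (cos x ^+ 2) (y ^+ 2); last first.
  apply/nbhs_dnbhs/(near_neq0 (f := fun u => cos u ^+ 2 - y ^+ 2)).
    apply: continuousB; last exact: cst_continuous.
    by apply: continuousM; exact: continuous_cos.
  by rewrite subr_eq0.
have nD : \forall u \near x^', sin (u + x) != 0.
  apply/nbhs_dnbhs/(near_neq0 (f := fun u => sin (u + x))).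
    apply: continuous_comp; last exact: continuous_sin.
    by apply: continuousD; [move=> ?; exact: cvg_id|exact: cst_continuous].
  rewrite sinD [cos x * _]mulrC -mulr2n mulrn_eq0 /= -sqrf_eq0 exprMn mulf_neq0 //.
    have -> : sin x ^+ 2 = 1 - y ^+ 2 by have := cos2Dsin2 x; lra.
    by rewrite gt_eqF // subr_gt0 expr_lt1 // ltW.
  by rewrite cx expf_neq0 // gt_eqF.
near=> u.
have -> : cos u ^+ 2 - y ^+ 2 = - (sin (u - x) * sin (u + x)).
  rewrite -cx sinB sinD; have := cos2Dsin2 u; have := cos2Dsin2 x => hx hu.
  have sx : sin x ^+ 2 = 1 - cos x ^+ 2 by lra.
  have su : sin u ^+ 2 = 1 - cos u ^+ 2 by lra.
  by ring: sx su.
rewrite oppr_eq0 mulf_neq0 //; near: u => //.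
exact: near_dnbhs_sin_sub.
Unshelve. all: by end_near. Qed.

Lemma continuous_sine_sum N (b : nat -> R) : continuous (sine_sum N b).
Proof.
suff h m : continuous (fun t => \sum_(j < m) b j * sin (j%:R * t)) by exact: h.
elim: m => [|m IH] t.
  have -> : (fun t => \sum_(j < 0) b j * sin (j%:R * t)) = cst 0.
    by apply/funext => u; rewrite big_ord0.
  exact: cst_continuous.
have -> : (fun t => \sum_(j < m.+1) b j * sin (j%:R * t)) =
    (fun t => \sum_(j < m) b j * sin (j%:R * t)) \+
    (cst (b m) \* (fun t => sin (m%:R * t))).
  by apply/funext => u; rewrite big_ord_recr.
apply: continuousD; first exact: IH.
apply: continuousM; first exact: cst_continuous.
apply: continuous_comp; last exact: continuous_sin.
by apply: continuousM; [exact: cst_continuous|move=> ?; exact: cvg_id].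
Qed.

Lemma continuous_ge0 (f : R -> R) x : continuous f ->
  (\forall u \near x^', 0 <= f u) -> 0 <= f x.
Proof.
move=> cf f0; apply: (cvgr_to_ge ((continuous_withinNx f x).1 (cf x))).
exact: f0.
Qed.

End Continuity.

(** * Extremizers *)

Section Extremizers.
Set Implicit Arguments.
Unset Strict Implicit.
Variable R : realType.
Local Notation C := R[i].
Local Notation Im := (@complex.Im R).
Local Notation toC := (map_poly (real_complex R)).
Local Notation U := (chebyshevU R).
Implicit Types (p h : {poly R}) (t y tau : R) (n N : nat).

(* The polynomial given by [twist tau P] for [P z = z * h (z ^+ 2)]. *)
Definition twist_poly tau h : {poly R} :=
  'X * (h \Po 'X^2) + (tau / 2) *: ('X * ('X * (h \Po 'X^2)) + (h \Po 'X^2) - 1).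

Lemma coef_comp_poly_X2 h i :
  (h \Po 'X^2)`_i = if odd i then 0 else h`_i./2.
Proof. by rewrite coef_comp_poly_Xn // dvdn2 divn2; case: odd. Qed.

(** [tau] enters only the even coefficients, so a_1 = h_0 and a_3 = h_1 survive the twist. The
    constant term is (tau / 2)(h_0 - 1), whence the subtracted tau / 2. *)
Lemma coef_twist_poly tau h i : (twist_poly tau h)`_i =
  if odd i then h`_i./2 else
  tau / 2 * ((if i is i'.+2 then h`_i'./2 else 0) + h`_i./2 - (i == 0%N)%:R).
Proof.
rewrite coefD coefZ coefB coefD !coefXM coef1.
case: i => [|[|i]] /=; rewrite !coef_comp_poly_X2 /=; [by rewrite add0r|ring|].
by rewrite uphalf_half; case: (odd i) => /=; rewrite ?add1n ?add0n; ring.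
Qed.

Lemma size_twist_poly tau h : (size (twist_poly tau h) <= (size h).*2.+1)%N.
Proof.
apply/leq_sizeP => i hi; rewrite coef_twist_poly.
have [oi|oi] := ifP; first by rewrite nth_default // geq_half_double ltnW.
case: i hi oi => [|[|i]] // hi oi.
rewrite /= in oi; rewrite negbK in oi.
rewrite !nth_default ?geq_half_double ?(ltnW hi) //=.
  by rewrite addr0 subr0 mulr0.
move: hi; rewrite !ltnS leq_eqVlt ltnS => /orP[/eqP e|//].
by have := odd_double (size h); rewrite e /= oi.
Qed.

Lemma size_twist_poly0 h : (size (twist_poly 0 h) <= (size h).*2)%N.
Proof.
apply/leq_sizeP => i hi; rewrite coef_twist_poly mul0r mul0r.
by case: ifP => // oi; rewrite nth_default // geq_half_double.
Qed.

Lemma horner_twist_poly tau h (z : C) : z != 0 ->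
  (toC (twist_poly tau h)).[z] = twist tau%:C (fun u => u * (toC h).[u ^+ 2]) z.
Proof.
move=> z0; rewrite /twist_poly rmorphD /= map_polyZ rmorphB rmorphD /= !rmorphM /=.
rewrite map_comp_poly map_polyX map_polyXn rmorph1 /=.
rewrite hornerD hornerZ hornerD hornerN hornerD !hornerM horner_comp hornerX.
rewrite hornerXn hornerC /twist [(2^-1)%:C]fmorphV rmorph_nat /=.
by field.
Qed.

Lemma im_circle_twist_poly tau h t : im_circle (toC (twist_poly tau h)) t =
  Im (expi t * (toC h).[expi t ^+ 2]) * (1 + tau * cos t).
Proof.
rewrite /im_circle -/(expi t) horner_twist_poly ?expi_neq0 // /twist -cosC.
rewrite ImB.
have -> : tau%:C / 2 = (tau / 2)%:C by rewrite fmorph_div rmorph_nat.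
have -> : 1 + tau%:C * (cos t)%:C = (1 + tau * cos t)%:C.
  by rewrite rmorphD rmorphM rmorph1.
by rewrite mulrC ImZ /= subr0 mulrC.
Qed.

(** The points outside [reg] are among the zeros of [D], hence isolated. *)
Lemma eq_by_continuity_horner (G : C -> C) (D P : {poly C}) (reg : pred C) :
    D != 0 -> (forall z, D.[z] != 0 -> reg z) ->
    (forall z, reg z -> P.[z] = G z) ->
  eq_by_continuity reg (horner P) G.
Proof.
move=> D0 Dreg PG; apply: eq_by_continuityP => //.
  exact: continuous_horner_num.
by move=> z; apply: filterS (near_dnbhs_horner_neq0 z D0) => u /Dreg.
Qed.

Lemma G_reg_poly (y z : C) :
  ('X * (1 - 'X^2) * (quad y \Po 'X^2)).[z] != 0 -> G_reg0 y z.
Proof.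
rewrite !hornerM horner_comp hornerD hornerN hornerXn hornerX hornerC.
rewrite quad_quartic /G_reg0 /G_reg !mulf_eq0 !negb_or => /andP[/andP[-> ->] ->].
by [].
Qed.

Lemma G_reg_poly_neq0 (y : C) :
  'X * (1 - 'X^2) * (quad y \Po 'X^2) != 0 :> {poly C}.
Proof.
have q0 : quad y != 0.
  apply/eqP => /(congr1 (fun p : {poly C} => p.[0])) /eqP.
  by rewrite horner_quad horner0 expr0n mulr0 !addr0 oner_eq0.
rewrite !mulf_neq0 ?polyX_eq0 //.
  apply/eqP => /(congr1 (fun p : {poly C} => p.[0])) /eqP.
  by rewrite hornerD hornerN hornerXn hornerC horner0 expr0n subr0 oner_eq0.
rewrite comp_poly_eq0 ?size_polyXn //.
Qed.

(** By [typreal_coefs] every competitor in [A] yields a nonnegative sine polynomial, so one bound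
    settles both problems. [A] and [B] stay abstract to cover both degree exactly N and degree at
    most N. *)
Lemma maximizers N p (A : set {poly C}) (B : set (nat -> R)) c : (0 < N)%N ->
    A `<=` typreal_le N -> B `<=` nonneg_sine_le N ->
    (forall a, nonneg_sine_le N a -> a 3%N <= c) -> p`_3 = c ->
    A (toC p) -> B (nth 0 p) -> im_circle (toC p) = sine_poly N (nth 0 p) ->
  is_maximizer (@a3 R) A (toC p) /\ sine_maximizer N B (im_circle (toC p)).
Proof.
move=> N0 AN BN bnd pc Ap Bp imE; split.
  split=> // P /AN /typreal_coefs/(_ N0)[q -> [_ _ _ /bnd qc]].
  by rewrite /a3 !coef_map pc; apply: etrans qc; exact: lecR.
exists (nth 0 p); split=> //; split=> // a /BN /bnd.
by rewrite pc.
Qed.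

Lemma minimizers N p (A : set {poly C}) (B : set (nat -> R)) c : (0 < N)%N ->
    A `<=` typreal_le N -> B `<=` nonneg_sine_le N ->
    (forall a, nonneg_sine_le N a -> c <= a 3%N) -> p`_3 = c ->
    A (toC p) -> B (nth 0 p) -> im_circle (toC p) = sine_poly N (nth 0 p) ->
  is_minimizer (@a3 R) A (toC p) /\ sine_minimizer N B (im_circle (toC p)).
Proof.
move=> N0 AN BN bnd pc Ap Bp imE; split.
  split=> // P /AN /typreal_coefs/(_ N0)[q -> [_ _ _ /bnd qc]].
  by rewrite /a3 !coef_map pc; apply: etrans qc; exact: lecR.
exists (nth 0 p); split=> //; split=> // a /BN /bnd.
by rewrite pc.
Qed.

Lemma typreal_sub N : typreal N `<=` @typreal_le R N.
Proof. by move=> P []. Qed.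

Lemma nonneg_sine_sub N : nonneg_sine N `<=` @nonneg_sine_le R N.
Proof. by move=> a []. Qed.

Lemma typreal_tau_sub tau N : typreal_tau tau N `<=` typreal_le N.
Proof.
by rewrite /typreal_tau; case: ifP => _; [exact: subset_refl|exact: typreal_sub].
Qed.

Lemma nonneg_sine_tau_sub tau N : nonneg_sine_tau tau N `<=` nonneg_sine_le N.
Proof.
rewrite /nonneg_sine_tau; case: ifP => _; first exact: subset_refl.
exact: nonneg_sine_sub.
Qed.

(** * From a quotient [h] to an extremizer, for either pair of rational functions *)

Section Fixed.
Variables (y : R) (h : {poly R}) (G : C -> C) (Th : R -> R).
Hypothesis yI : 0 < y < 1.
Hypothesis GE : forall z, G_reg y%:C z -> G z = z * (toC h).[z ^+ 2].
Hypothesis ThE : forall t, Theta_reg y t -> Im (G (expi t)) = Th t.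
Hypothesis Th_ge0 : forall t, 0 < sin t -> 0 <= Th t.
Hypothesis h0 : h`_0 = 1.
Hypothesis h1 : h`_1 = 4 * y ^+ 2 - 1.

Lemma twist_poly_continuity tau :
  eq_by_continuity (G_reg0 y%:C) (horner (toC (twist_poly tau h)))
    (twist tau%:C G).
Proof.
apply: (eq_by_continuity_horner (G_reg_poly_neq0 y%:C) (@G_reg_poly _)).
by move=> z /andP[z0 zr]; rewrite horner_twist_poly // /twist -GE.
Qed.

(** [G_reg] admits z = 0, where the untwisted fraction has no pole; both sides vanish there. *)
Lemma twist_poly0_continuity :
  eq_by_continuity (G_reg y%:C) (horner (toC (twist_poly 0 h))) G.
Proof.
apply: (eq_by_continuity_horner (G_reg_poly_neq0 y%:C)).
  by move=> z /G_reg_poly /andP[].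
move=> z; have [->|z0] := eqVneq z 0 => zr.
  by rewrite GE // mul0r horner_coef0 coef_map coef_twist_poly /= !mul0r.
by rewrite horner_twist_poly // /twist !mul0r addr0 subr0 mulr1 GE.
Qed.

Lemma im_circle_twist_poly_continuity tau :
  eq_by_continuity (Theta_reg y) (im_circle (toC (twist_poly tau h)))
    (fun t => Th t * (1 + tau * cos t)).
Proof.
apply: eq_by_continuityP.
- have -> : im_circle (toC (twist_poly tau h)) =
      sine_sum (size (twist_poly tau h)) (nth 0 (twist_poly tau h)).
    by apply/funext => t; apply: im_circleE.
  exact: continuous_sine_sum.
- move=> t tr; rewrite im_circle_twist_poly -ThE // GE //.
  by have [_ _ ->] := Theta_reg_expi tr.
- by move=> t; exact: near_Theta_reg.
Qed.

(** The range of [tau] makes 1 + tau cos t nonnegative. The other factor is [Th] at regular points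
    and a limit of such values at singular points inside (0, pi); at 0 and pi every sine
    vanishes. *)
Lemma im_circle_twist_poly_ge0 tau t : -1 <= tau <= 1 -> 0 <= t <= pi ->
  0 <= im_circle (toC (twist_poly tau h)) t.
Proof.
move=> /andP[tau1 tau2] /andP[t0 tpi].
have f0 : 0 <= 1 + tau * cos t.
  have := cos_le1 t; have := cos_geN1 t; nra.
rewrite im_circle_twist_poly mulr_ge0 //.
have -> : Im (expi t * (toC h).[expi t ^+ 2]) =
    im_circle (toC (twist_poly 0 h)) t.
  by rewrite im_circle_twist_poly mul0r addr0 mulr1.
have cS u : im_circle (toC (twist_poly 0 h)) u =
  sine_sum (size (twist_poly 0 h)) (nth 0 (twist_poly 0 h)) u by exact: im_circleE.
have [->|tn0] := eqVneq t 0.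
  by rewrite cS /sine_sum big1 // => j _; rewrite mulr0 sin0 mulr0.
have [->|tnpi] := eqVneq t pi.
  by rewrite cS /sine_sum big1 // => j _; rewrite sin_natpi mulr0.
have st : 0 < sin t by rewrite sin_gt0_pi // !lt_def tn0 t0 eq_sym tnpi.
rewrite cS; apply: continuous_ge0; first exact: continuous_sine_sum.
have nst : \forall u \near t^', 0 < sin u.
  by apply: nbhs_dnbhs; exact: (cvgr_gt (sin t) (@continuous_sin R t)).
near=> u.
have ur : Theta_reg y u by near: u; exact: near_Theta_reg.
rewrite -cS im_circle_twist_poly mul0r addr0 mulr1 -GE; last first.
  by have [_ _ ->] := Theta_reg_expi ur.
by rewrite ThE // Th_ge0 //; near: u.
Unshelve. all: by end_near. Qed.

Lemma im_circle_twist_poly0_continuity :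
  eq_by_continuity (Theta_reg y) (im_circle (toC (twist_poly 0 h))) Th.
Proof.
rewrite (_ : Th = fun t => Th t * (1 + 0 * cos t)).
  exact: im_circle_twist_poly_continuity.
by apply/funext => t; rewrite mul0r addr0 mulr1.
Qed.

Lemma twist_poly_classes tau N : -1 <= tau <= 1 -> (0 < N)%N ->
    (size (twist_poly tau h) <= N.+1)%N ->
  [/\ typreal_le N (toC (twist_poly tau h)),
      nonneg_sine_le N (nth 0 (twist_poly tau h))
    & im_circle (toC (twist_poly tau h)) =
      sine_poly N (nth 0 (twist_poly tau h))].
Proof.
move=> tauI N0; have S0 t := @im_circle_twist_poly_ge0 tau t tauI.
have p0 : (twist_poly tau h)`_0 = 0.
  by rewrite coef_twist_poly /= h0 add0r subrr mulr0.
have p1 : (twist_poly tau h)`_1 = 1 by rewrite coef_twist_poly.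
move: (twist_poly tau h) S0 p0 p1 => p S0 p0 p1 sp.
have imE : im_circle (toC p) = sine_poly N (nth 0 p).
  apply/funext => t; rewrite (im_circleE _ sp) sine_polyE //.
  by apply: eq_bigr => j _; case: eqP => // ->; rewrite p1.
split=> //; last by move=> t tI; rewrite -imE S0.
split; rewrite ?size_map_poly ?coef_map ?p0 ?p1 //.
exact: typically_real_of_nonneg.
Qed.

Lemma odd_extremizer N : N.+1 = (size h).*2 -> (0 < N)%N ->
  [/\ typreal N (toC (twist_poly 0 h)), nonneg_sine N (nth 0 (twist_poly 0 h))
    & im_circle (toC (twist_poly 0 h)) = sine_poly N (nth 0 (twist_poly 0 h))].
Proof.
move=> Nh N0; have [|||? ? ?] := @twist_poly_classes 0 N => //.
- by rewrite oppr_le0 ler01.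
- by rewrite Nh size_twist_poly0.
have pN : (twist_poly 0 h)`_N != 0.
  have oN : odd N by have := odd_double (size h); rewrite -Nh /= => /negbFE.
  rewrite coef_twist_poly oN.
  have -> : N./2 = (size h).-1.
    by rewrite -(doubleK (size h)) -Nh /= uphalf_half oN.
  rewrite -lead_coefE lead_coef_eq0; apply: contra_eq_neq Nh => ->.
  by rewrite size_poly0.
by split=> //; split=> //; rewrite coef_map fmorph_eq0.
Qed.

(** The coefficient of z^N is tau / 2 times the leading coefficient of [h]: the degree is exactly N
    unless tau = 0. *)
Lemma even_extremizer tau N : -1 <= tau <= 1 -> N = (size h).*2 -> (0 < N)%N ->
  [/\ typreal_tau tau N (toC (twist_poly tau h)),
      nonneg_sine_tau tau N (nth 0 (twist_poly tau h))
    & im_circle (toC (twist_poly tau h)) =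
      sine_poly N (nth 0 (twist_poly tau h))].
Proof.
move=> tauI Nh N0; 
have sz : (size (twist_poly tau h) <= N.+1)%N by rewrite Nh size_twist_poly.
have [? ? ?] := twist_poly_classes tauI N0 sz.
rewrite /typreal_tau /nonneg_sine_tau; case: eqVneq => // tau0.
have pN : (twist_poly tau h)`_N != 0.
  rewrite coef_twist_poly {1}Nh odd_double.
  have -> : N./2 = size h by rewrite Nh doubleK.
  rewrite (nth_default _ (leqnn (size h))) addr0.
  rewrite (gtn_eqF N0) subr0 mulf_neq0 // ?mulf_neq0 ?invr_eq0 ?pnatr_eq0 //.
  have hs0 : (0 < size h)%N by move: N0; rewrite Nh double_gt0.
  have -> : N = ((size h).-1.*2).+2 by rewrite Nh -doubleS prednK.
  by rewrite /= doubleK -lead_coefE lead_coef_eq0 -size_poly_gt0.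
by split=> //; split=> //; rewrite coef_map fmorph_eq0.
Qed.

Lemma odd_maximizer N : N.+1 = (size h).*2 -> (0 < N)%N ->
    (forall a, nonneg_sine_le N a -> a 3%N <= 4 * y ^+ 2 - 1) ->
  exists P : {poly C},
    [/\ eq_by_continuity (G_reg y%:C) (horner P) G,
        is_maximizer (@a3 R) (typreal N) P,
        sine_maximizer N (nonneg_sine N) (im_circle P)
      & eq_by_continuity (Theta_reg y) (im_circle P) Th].
Proof.
move=> Nh N0 bnd; have [Ap Bp imE] := odd_extremizer Nh N0.
have p3 : (twist_poly 0 h)`_3 = 4 * y ^+ 2 - 1 by rewrite coef_twist_poly.
have [mP mS] := maximizers N0 (@typreal_sub N) (@nonneg_sine_sub N) bnd p3
  Ap Bp imE.
exists (toC (twist_poly 0 h)); split=> //; first exact: twist_poly0_continuity.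
exact: im_circle_twist_poly0_continuity.
Qed.

Lemma odd_minimizer N : N.+1 = (size h).*2 -> (0 < N)%N ->
    (forall a, nonneg_sine_le N a -> 4 * y ^+ 2 - 1 <= a 3%N) ->
  exists P : {poly C},
    [/\ eq_by_continuity (G_reg y%:C) (horner P) G,
        is_minimizer (@a3 R) (typreal N) P,
        sine_minimizer N (nonneg_sine N) (im_circle P)
      & eq_by_continuity (Theta_reg y) (im_circle P) Th].
Proof.
move=> Nh N0 bnd; have [Ap Bp imE] := odd_extremizer Nh N0.
have p3 : (twist_poly 0 h)`_3 = 4 * y ^+ 2 - 1 by rewrite coef_twist_poly.
have [mP mS] := minimizers N0 (@typreal_sub N) (@nonneg_sine_sub N) bnd p3
  Ap Bp imE.
exists (toC (twist_poly 0 h)); split=> //; first exact: twist_poly0_continuity.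
exact: im_circle_twist_poly0_continuity.
Qed.

Lemma even_maximizer tau N : -1 <= tau <= 1 -> N = (size h).*2 -> (0 < N)%N ->
    (forall a, nonneg_sine_le N a -> a 3%N <= 4 * y ^+ 2 - 1) ->
  exists P : {poly C},
    [/\ eq_by_continuity (G_reg0 y%:C) (horner P) (twist tau%:C G),
        is_maximizer (@a3 R) (typreal_tau tau N) P,
        sine_maximizer N (nonneg_sine_tau tau N) (im_circle P)
      & eq_by_continuity (Theta_reg y) (im_circle P)
          (fun t => Th t * (1 + tau * cos t))].
Proof.
move=> tauI Nh N0 bnd; have [Ap Bp imE] := even_extremizer tauI Nh N0.
have p3 : (twist_poly tau h)`_3 = 4 * y ^+ 2 - 1 by rewrite coef_twist_poly.
have [mP mS] := maximizers N0 (@typreal_tau_sub tau N) (@nonneg_sine_tau_sub tau N) bnd p3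
  Ap Bp imE.
exists (toC (twist_poly tau h)); split=> //; first exact: twist_poly_continuity.
exact: im_circle_twist_poly_continuity.
Qed.

Lemma even_minimizer tau N : -1 <= tau <= 1 -> N = (size h).*2 -> (0 < N)%N ->
    (forall a, nonneg_sine_le N a -> 4 * y ^+ 2 - 1 <= a 3%N) ->
  exists P : {poly C},
    [/\ eq_by_continuity (G_reg0 y%:C) (horner P) (twist tau%:C G),
        is_minimizer (@a3 R) (typreal_tau tau N) P,
        sine_minimizer N (nonneg_sine_tau tau N) (im_circle P)
      & eq_by_continuity (Theta_reg y) (im_circle P)
          (fun t => Th t * (1 + tau * cos t))].
Proof.
move=> tauI Nh N0 bnd; have [Ap Bp imE] := even_extremizer tauI Nh N0.
have p3 : (twist_poly tau h)`_3 = 4 * y ^+ 2 - 1 by rewrite coef_twist_poly.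
have [mP mS] := minimizers N0 (@typreal_tau_sub tau N) (@nonneg_sine_tau_sub tau N) bnd p3
  Ap Bp imE.
exists (toC (twist_poly tau h)); split=> //; first exact: twist_poly_continuity.
exact: im_circle_twist_poly_continuity.
Qed.

End Fixed.

Lemma ratio_ge0 (a b s u v : R) : 0 <= a -> 0 <= b -> 0 <= s -> 0 <= u ->
  0 <= v -> 0 <= 2 * a * b / s * (u / v).
Proof. by move=> *; rewrite !mulr_ge0 ?invr_ge0. Qed.

Lemma Theta_ge0 M y t : 0 < y < 1 -> 0 < sin t -> 0 <= Theta M t y.
Proof.
move=> /andP[y0 y1] /ltW st; apply: ratio_ge0; rewrite ?sqr_ge0 //.
  by rewrite subr_ge0 expr_le1 // ltW.
by apply: mulr_ge0; rewrite ?sqr_ge0.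
Qed.

Lemma hatTheta_ge0 M y t : (2 <= M)%N -> 0 < y < 1 -> 0 < sin t ->
  0 <= hatTheta M t y.
Proof.
move=> M2 /andP[y0 y1] /ltW st; apply: ratio_ge0; rewrite ?sqr_ge0 //.
- by rewrite subr_ge0 expr_le1 // ltW.
- exact: exprn_ge0.
- by rewrite -natrB // -natrD; apply: mulr_ge0; rewrite ?sqr_ge0 // -!natrM.
Qed.

Lemma extremizer12 n y : (1 < n)%N -> 0 < y < 1 -> root (U n) y ->
  exists h, [/\ size h = n.-1, h`_0 = 1, h`_1 = 4 * y ^+ 2 - 1 &
    forall z, G_reg y%:C z ->
      G1 n.+1.*2 z y%:C + G2 z y%:C = z * (toC h).[z ^+ 2]].
Proof.
move=> n1 yI yr; have [h [numE sh h0 h1]] := quotient12 n1 yI yr.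
exists h; split=> // z zr; rewrite G12_fraction //.
rewrite -[num12 n _](map_num12 (real_complex R)) numE rmorphM.
rewrite hornerM /= map_den12 mulfK //.
move/andP: zr => [z1 q0].
by rewrite den12_horner quad_quartic mulf_neq0 ?expf_neq0.
Qed.

Lemma extremizer34 n y : (1 < n)%N -> 0 < y < 1 -> root (U n)^`() y ->
  exists h, [/\ size h = n.-1, h`_0 = 1, h`_1 = 4 * y ^+ 2 - 1 &
    forall z, G_reg y%:C z ->
      G3 n.+1.*2 z y%:C + G4 n.+1.*2 z y%:C = z * (toC h).[z ^+ 2]].
Proof.
case: n => // n n1 yI yr; have [h [numE sh h0 h1]] := quotient34 n1 yI yr.
exists h; split=> // z zr; rewrite G34_fraction //.
rewrite -[num34 _ _](map_num34 (real_complex R)) numE rmorphM.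
rewrite hornerM /= map_den34 mulfK //.
move/andP: zr => [z1 q0].
by rewrite den34_horner quad_quartic mulf_neq0 ?expf_neq0.
Qed.

End Extremizers.

Theorem corollary1 (R : realType) (N : nat) (hN : (3 <= N)%N) :
  (* (a) *)
  (odd N ->
   forall y : R, is_max_root (chebyshevU R (N + 3)./2) y ->
   exists P : {poly R[i]},
     [/\ eq_by_continuity (G_reg y%:C) (horner P)
           (fun z => G1 (Mdeg N) z y%:C + G2 z y%:C),
         is_maximizer (@a3 R) (typreal N) P,
         sine_maximizer N (nonneg_sine N) (im_circle P)
       & eq_by_continuity (Theta_reg y) (im_circle P)
           (fun t => Theta (Mdeg N) t y)]) /\
  (* (b) *)
  (~~ odd N ->
   forall y : R, is_max_root (chebyshevU R (N + 2)./2) y ->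
   forall tau : R, -1 <= tau <= 1 ->
   exists P : {poly R[i]},
     [/\ eq_by_continuity (G_reg0 y%:C) (horner P)
           (twist tau%:C (fun z => G1 (Mdeg N) z y%:C + G2 z y%:C)),
         is_maximizer (@a3 R) (typreal_tau tau N) P,
         sine_maximizer N (nonneg_sine_tau tau N) (im_circle P)
       & eq_by_continuity (Theta_reg y) (im_circle P)
           (fun t => Theta (Mdeg N) t y * (1 + tau * cos t))]) /\
  (* (c) *)
  (odd N -> odd (N + 3)./2 ->
   forall y : R, is_min_pos_root (chebyshevU R (N + 3)./2)^`() y ->
   exists P : {poly R[i]},
     [/\ eq_by_continuity (G_reg y%:C) (horner P)
           (fun z => G3 (Mdeg N) z y%:C + G4 (Mdeg N) z y%:C),
         is_minimizer (@a3 R) (typreal N) P,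
         sine_minimizer N (nonneg_sine N) (im_circle P)
       & eq_by_continuity (Theta_reg y) (im_circle P)
           (fun t => hatTheta (Mdeg N) t y)]) /\
  (* (d) *)
  (odd N -> ~~ odd (N + 3)./2 ->
   forall y : R, is_min_pos_root (chebyshevU R (N + 3)./2) y ->
   exists P : {poly R[i]},
     [/\ eq_by_continuity (G_reg y%:C) (horner P)
           (fun z => G1 (Mdeg N) z y%:C + G2 z y%:C),
         is_minimizer (@a3 R) (typreal N) P,
         sine_minimizer N (nonneg_sine N) (im_circle P)
       & eq_by_continuity (Theta_reg y) (im_circle P)
           (fun t => Theta (Mdeg N) t y)]) /\
  (* (e) *)
  (~~ odd N -> odd (N + 2)./2 ->
   forall y : R, is_min_pos_root (chebyshevU R (N + 2)./2)^`() y ->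
   forall tau : R, -1 <= tau <= 1 ->
   exists P : {poly R[i]},
     [/\ eq_by_continuity (G_reg0 y%:C) (horner P)
           (twist tau%:C (fun z => G3 (Mdeg N) z y%:C + G4 (Mdeg N) z y%:C)),
         is_minimizer (@a3 R) (typreal_tau tau N) P,
         sine_minimizer N (nonneg_sine_tau tau N) (im_circle P)
       & eq_by_continuity (Theta_reg y) (im_circle P)
           (fun t => hatTheta (Mdeg N) t y * (1 + tau * cos t))]) /\
  (* (f) *)
  (~~ odd N -> ~~ odd (N + 2)./2 ->
   forall y : R, is_min_pos_root (chebyshevU R (N + 2)./2) y ->
   forall tau : R, -1 <= tau <= 1 ->
   exists P : {poly R[i]},
     [/\ eq_by_continuity (G_reg0 y%:C) (horner P)
           (twist tau%:C (fun z => G1 (Mdeg N) z y%:C + G2 z y%:C)),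
         is_minimizer (@a3 R) (typreal_tau tau N) P,
         sine_minimizer N (nonneg_sine_tau tau N) (im_circle P)
       & eq_by_continuity (Theta_reg y) (im_circle P)
           (fun t => Theta (Mdeg N) t y * (1 + tau * cos t))]).
Proof.
split; [|split; [|split; [|split; [|split]]]].
- move=> oN y yr; pose n := (N + 3)./2.
  have nE : n.*2 = (N + 3)%N by rewrite /n; lia.
  have n1 : (1 < n)%N by lia.
  have -> : Mdeg N = n.+1.*2 by rewrite /Mdeg oN; lia.
  have yI : 0 < y < 1 by exact: max_root_itv n1 yr.
  have [h [sh h0 h1 GE]] := extremizer12 n1 yI yr.1.
  have ThE := fun t => @Im_G12 R n y t.
  have Th0 := fun t => @Theta_ge0 R n.+1.*2 y t yI.
  apply: (odd_maximizer yI GE ThE Th0 h0 h1); [lia|lia|] => a aN.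
  apply: (sine_poly_gaussU_le (n := n) hN _ aN); first lia.
  by move=> x; exact: max_root_sqr_le yr.
- move=> eN y yr tau tauI; pose n := (N + 2)./2.
  have nE : n.*2 = (N + 2)%N by rewrite /n; lia.
  have n1 : (1 < n)%N by lia.
  have -> : Mdeg N = n.+1.*2 by rewrite /Mdeg (negbTE eN); lia.
  have yI : 0 < y < 1 by exact: max_root_itv n1 yr.
  have [h [sh h0 h1 GE]] := extremizer12 n1 yI yr.1.
  have ThE := fun t => @Im_G12 R n y t.
  have Th0 := fun t => @Theta_ge0 R n.+1.*2 y t yI.
  apply: (even_maximizer yI GE ThE Th0 h0 h1 tauI); [lia|lia|] => a aN.
  apply: (sine_poly_gaussU_le (n := n) hN _ aN); first lia.
  by move=> x; exact: max_root_sqr_le yr.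
- move=> oN on y yr; pose n := (N + 3)./2.
  have nE : n.*2 = (N + 3)%N by rewrite /n; lia.
  have n1 : (1 < n)%N by lia.
  have -> : Mdeg N = n.+1.*2 by rewrite /Mdeg oN; lia.
  have yI : 0 < y < 1 by exact: min_pos_root_deriv_itv n1 yr.
  have [_ yr0 _] := yr.
  have [h [sh h0 h1 GE]] := extremizer34 n1 yI yr0.
  have ThE := fun t => @Im_G34 R n y t (ltnW n1).
  have Th0 := fun t => @hatTheta_ge0 R n.+1.*2 y t isT yI.
  apply: (odd_minimizer yI GE ThE Th0 h0 h1); [lia|lia|] => a aN.
  apply: (sine_poly_lobatto_ge (n := n) hN _ _ aN); [lia|lia| |].
    by case/andP: yI => y0 y1; rewrite expr_le1 // ltW.
  move=> x xr; apply: (min_pos_root_sqr_ge (root_deriv_chebyshevUN n) yr) => //.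
  (* Oddness of [n] enters here: 0 is a zero of U_n but not of U_n'. *)
  by apply: contraTneq xr => ->; exact: deriv_chebyshevU_root0.
- move=> oN en y yr; pose n := (N + 3)./2.
  have nE : n.*2 = (N + 3)%N by rewrite /n; lia.
  have n1 : (1 < n)%N by lia.
  have -> : Mdeg N = n.+1.*2 by rewrite /Mdeg oN; lia.
  have yI : 0 < y < 1 by exact: min_pos_root_itv n1 yr.
  have [_ yr0 _] := yr.
  have [h [sh h0 h1 GE]] := extremizer12 n1 yI yr0.
  have ThE := fun t => @Im_G12 R n y t.
  have Th0 := fun t => @Theta_ge0 R n.+1.*2 y t yI.
  apply: (odd_minimizer yI GE ThE Th0 h0 h1); [lia|lia|] => a aN.
  apply: (sine_poly_gaussU_ge (n := n) hN _ aN); first lia.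
  move=> x xr; apply: (min_pos_root_sqr_ge (root_chebyshevUN n) yr) => //.
  (* For even [n], 0 is not a Gauss node, so the Gauss bound suffices for the minimum. *)
  by apply: contraTneq xr => ->; exact: chebyshevU_root0.
- move=> eN on y yr tau tauI; pose n := (N + 2)./2.
  have nE : n.*2 = (N + 2)%N by rewrite /n; lia.
  have n1 : (1 < n)%N by lia.
  have -> : Mdeg N = n.+1.*2 by rewrite /Mdeg (negbTE eN); lia.
  have yI : 0 < y < 1 by exact: min_pos_root_deriv_itv n1 yr.
  have [_ yr0 _] := yr.
  have [h [sh h0 h1 GE]] := extremizer34 n1 yI yr0.
  have ThE := fun t => @Im_G34 R n y t (ltnW n1).
  have Th0 := fun t => @hatTheta_ge0 R n.+1.*2 y t isT yI.
  apply: (even_minimizer yI GE ThE Th0 h0 h1 tauI); [lia|lia|] => a aN.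
  apply: (sine_poly_lobatto_ge (n := n) hN _ _ aN); [lia|lia| |].
    by case/andP: yI => y0 y1; rewrite expr_le1 // ltW.
  move=> x xr; apply: (min_pos_root_sqr_ge (root_deriv_chebyshevUN n) yr) => //.
  by apply: contraTneq xr => ->; exact: deriv_chebyshevU_root0.
- move=> eN en y yr tau tauI; pose n := (N + 2)./2.
  have nE : n.*2 = (N + 2)%N by rewrite /n; lia.
  have n1 : (1 < n)%N by lia.
  have -> : Mdeg N = n.+1.*2 by rewrite /Mdeg (negbTE eN); lia.
  have yI : 0 < y < 1 by exact: min_pos_root_itv n1 yr.
  have [_ yr0 _] := yr.
  have [h [sh h0 h1 GE]] := extremizer12 n1 yI yr0.
  have ThE := fun t => @Im_G12 R n y t.
  have Th0 := fun t => @Theta_ge0 R n.+1.*2 y t yI.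
  apply: (even_minimizer yI GE ThE Th0 h0 h1 tauI); [lia|lia|] => a aN.
  apply: (sine_poly_gaussU_ge (n := n) hN _ aN); first lia.
  move=> x xr; apply: (min_pos_root_sqr_ge (root_chebyshevUN n) yr) => //.
  by apply: contraTneq xr => ->; exact: chebyshevU_root0.
Qed.
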